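(* Let $\mathbf P_{\mathcal N}$ denote the standard Gaussian distribution on $\mathbf R$ and let $\mathcal H$ be a class of functions included in $\operatorname{Lip}_1$. For any $F:E_A\to\mathbf R$ such that $F\in\mathbf D$ (the domain of $D$) and $\mathbf E[F]=0$, $$\kappa_{\mathcal H}(\mathbf P_{\mathcal N},\mathbf P_F)\le\mathbf E\left[\left|1-\sum_{a\in A}D_aF\,(-D_aL^{-1}F)\right|\right]+\sum_{a\in A}\mathbf E\left[\int_{E_a}\big(F-F(X_{A\setminus\{a\}};x)\big)^2d\mathbf P_a(x)\;|D_aL^{-1}F|\right].$$
   Context: $A$ is an at most countable set, $(E_a,\mathcal E_a,\mathbf P_a)_{a\in A}$ are Polish spaces with probability measures, $E_A=\prod_{a\in A}E_a$ carries the product $\sigma$-field and the product measure $\otimes_{a\in A}\mathbf P_a$, with expectation $\mathbf E$; $X_A=(X_a)_{a\in A}$ are the coordinate random variables and $F$ is identified with $F(X_A)$. $F(X_{A\setminus\{a\}};x)$ is $F$ evaluated at $X_A$ with its $a$-th coordinate replaced by $x$. The gradient is $D_aF=F-\int_{E_a}F(X_{A\setminus\{a\}};x)\,d\mathbf P_a(x)$. $\mathbf D$ is the closure of the cylindrical random variables (elements of $L^2(E_A)$ depending on finitely many coordinates) for the norm $(\mathbf E[F^2]+\sum_a\mathbf E[|D_aF|^2])^{1/2}$. The divergence $\delta$ is the adjoint of $D$ (from $L^2(E_A)$ into the space of families $(U_a)_{a\in A}$ with $\sum_a\mathbf E[U_a^2]<\infty$) and $L=-\delta D$, formally $LF=-\sum_aD_aF$.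 For centered $F\in L^2(E_A)$, $L^{-1}F$ is the unique centered $G\in\mathbf D$ with $LG=F$, i.e. $\sum_a\mathbf E[D_aG\,D_aH]=-\mathbf E[FH]$ for all $H\in\mathbf D$. $\operatorname{Lip}_r$ is the set of $\varphi:\mathbf R\to\mathbf R$ with $|\varphi(x)-\varphi(y)|\le r|x-y|$ for all $x,y$. For probability measures $\mu,\nu$ on $\mathbf R$, $\kappa_{\mathcal H}(\mu,\nu)=\sup_{\varphi\in\mathcal H}|\int\varphi\,d\mu-\int\varphi\,d\nu|$. $\mathbf P_F$ is the law of $F$. *)

(* Defs.v *)
From HB Require Import structures.
From mathcomp Require Import all_boot all_order all_algebra finmap.
From mathcomp Require Import all_classical all_reals all_analysis.

Set Implicit Arguments.
Unset Strict Implicit.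
Unset Printing Implicit Defensive.

Import Order.TTheory GRing.Theory Num.Theory.
Import numFieldNormedType.Exports.

Local Open Scope classical_set_scope.
Local Open Scope ring_scope.

(* A Polish space: the topology comes from a complete separable metric. *)
Definition polish (R : realType) (T : topologicalType) : Prop :=
  (exists2 S : set T, countable S & dense S) /\
  exists dist : T -> T -> R,
    [/\ (forall x y, 0 <= dist x y /\ (dist x y = 0 <-> x = y)),
        (forall x y, dist x y = dist y x),
        (forall x y z, dist x z <= dist x y + dist y z),
        (forall x (U : set T), nbhs x U <->
           exists2 e, 0 < e & [set y | dist x y < e] `<=` U)
      & (forall u : nat -> T,
           (forall e, 0 < e -> exists N : nat, forall m n : nat,
              (N <= m)%N -> (N <= n)%N -> dist (u m) (u n) < e) ->
           exists l : T, u @ \oo --> l)].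

Notation borel T := (g_sigma_algebraType (@open T)).

(* Sum of a family over a countable index set, independent of any enumeration:
   the sum of the positive parts minus the sum of the negative parts, which is
   the usual sum when the family is absolutely summable. *)
Definition usum (R : realType) (A : countType) (f : A -> R) : R :=
  fine (\esum_(a in [set: A]) (EFin \o f)^\+ a -
        \esum_(a in [set: A]) (EFin \o f)^\- a)%E.

Definition coord_sets (A : Type) (d : A -> measure_display)
    (E : forall a, measurableType (d a)) : set (set (forall a, E a)) :=
  [set C | exists a, exists2 B : set (E a), measurable B
                                          & C = [set x | B (x a)]].

Arguments coord_sets {A d} E _.

Notation prod_space E := (g_sigma_algebraType (coord_sets E)).

Section malliavin.
Context {R : realType} {A : countType} {d : A -> measure_display}.
Context {E : forall a, measurableType (d a)}.
Variable P : forall a, probability (E a) R.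

(* Finite-dimensional rectangles form a pi-system generating the product
   sigma-field, so this determines PA. *)
Definition is_product_measure (PA : probability (prod_space E) R) : Prop :=
  forall (J : {fset A}) (B : forall a, set (E a)),
    (forall a, measurable (B a)) ->
    PA [set x | forall a, a \in J -> B a (x a)]
    = (\prod_(a <- J) fine (P a (B a)))%:E.

Definition grad (F : prod_space E -> R) (a : A) (x : prod_space E) : R :=
  F x - \int[P a]_y F (dfwith x a y).

Variable PA : probability (prod_space E) R.

Definition cylindrical (F : prod_space E -> R) : Prop :=
  F \in Lfun PA 2%:E /\
  exists J : {fset A}, forall x y : prod_space E,
    (forall a, a \in J -> x a = y a) -> F x = F y.

Definition D_norm (F : prod_space E -> R) : \bar R :=
  (('E_PA[fun x => (F x ^+ 2)%R] +
    \esum_(a in [set: A]) 'E_PA[fun x => (`|grad F a x| ^+ 2)%R]) `^ (2^-1))%E.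

Definition in_D (F : prod_space E -> R) : Prop :=
  F \in Lfun PA 2%:E /\
  forall e : R, 0 < e ->
    exists2 C, cylindrical C & (D_norm (fun x => F x - C x)%R < e%:E)%E.

(* U belongs to the domain of the divergence and V = delta U. *)
Definition is_divergence (U : A -> prod_space E -> R) (V : prod_space E -> R)
    : Prop :=
  [/\ (forall a, U a \in Lfun PA 2%:E),
      (\esum_(a in [set: A]) 'E_PA[fun x => (U a x ^+ 2)%R] < +oo)%E,
      V \in Lfun PA 2%:E
    & forall H, in_D H ->
        usum (fun a => fine 'E_PA[fun x => (U a x * grad H a x)%R])
        = fine 'E_PA[fun x => (V x * H x)%R]].

(* G belongs to the domain of L = - delta D and F = L G. *)
Definition is_L (G F : prod_space E -> R) : Prop :=
  in_D G /\ is_divergence (grad G) (fun x => - F x).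

(* G is a version of L^-1 F. *)
Definition is_Linv (F G : prod_space E -> R) : Prop :=
  ('E_PA[G] = 0)%E /\ is_L G F.

End malliavin.

Definition Lip (R : realType) (r : R) : set (R -> R) :=
  [set phi | forall x y, `|phi x - phi y| <= r * `|x - y|].

(* mu and nu are typed as set functions because the library attaches the
   structures of its Gaussian and of distributions to two different names of the
   Borel sigma-field of R. *)
Definition kappa (R : realType) (H : set (R -> R))
    (mu nu : set R -> \bar R) : \bar R :=
  ereal_sup [set `| \int[mu]_x (phi x)%:E - \int[nu]_x (phi x)%:E |%E
            | phi in H].

(* Main.v *)
(** For a 1-Lipschitz [phi], let [f] solve Stein's equation
    [f' x - x f x = phi x - E phi(N)], so that [E phi(F) - E phi(N)] is
    [E[f'(F)] - E[F f(F)]].  Since [F = L L^-1 F], integration by parts rewrites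
    [E[F f(F)]] as [- sum_a E[D_a L^-1 F D_a f(F)]], and expanding [f] to first
    order between [F] and its resampled version replaces [D_a f(F)] by
    [f'(F) D_a F], up to [\int (F - F(X_{A\a}; x))^2 dP_a(x)].  The constants are
    the right ones because [|f'| <= 1] and [f'] is 2-Lipschitz.

    The second bound follows from a monotonicity property: if the right-hand side
    of Stein's equation is nondecreasing, then [x f x] is nonincreasing, by Mills'
    inequality.  Applying this to [x + phi x] and [x - phi x] shows that [x f x]
    is 1-Lipschitz, and [f' x = x f x + phi x - E phi(N)].  The first bound
    reduces to [2 E(N - x)^+ E(N - x)^- <= p x] with [p] the Gaussian density,
    which is a consequence of Birnbaum's inequality for Mills' ratio. *)
Require Import Defs.
From HB Require Import structures.
From mathcomp Require Import all_boot all_order all_algebra finmap.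
From mathcomp Require Import all_classical all_reals all_analysis.
From mathcomp Require Import measurable_realfun ring lra.

Set Implicit Arguments.
Unset Strict Implicit.
Unset Printing Implicit Defensive.

Import Order.TTheory GRing.Theory Num.Theory.
Import numFieldNormedType.Exports.

Local Open Scope classical_set_scope.
Local Open Scope ring_scope.

(** What separates the formal computation from a proof is integrability: [F] is only a limit of
    cylindrical variables, the sum over [a] may be infinite, and the second term of the bound may be
    [+oo]. The formula for E[F f(F)] is therefore proved only up to an error [e], with a sum over a
    finite set [S] of indices, and [e] disappears at the very end. The indices outside [S] are paid
    for by the sum of E|D_aF D_aL^-1F|, which converges because both gradients are square summable.
    All terms of the bound are integrals of nonnegative extended functions, so an infinite
    right-hand side needs no separate case.

    The L^2 estimates on the product space freely lose factors 2 and 4, since these affect only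
    errors that vanish. The sharp constants come from the Gaussian side alone. There, the positivity
    of the integral of (t - c)^2 over a half-line gives both classical inequalities: [c = x] yields
    Mills' and the discriminant in [c] yields Birnbaum's.

    As [phi] is merely Lipschitz, f'' need not exist; the Lipschitz bound on f' takes its place in
    the expansion, and half of that bound is the coefficient of the quadratic remainder. *)

Section monotone_derivative.
Context {R : realType}.
Implicit Types f df : R -> R.

Lemma nondecreasing_of_derive_ge0 f df :
  (forall x, is_derive x (1 : R) f (df x)) -> (forall x, 0 <= df x) ->
  {homo f : x y / x <= y}.
Proof.
move=> dfE df0 x y; rewrite le_eqVlt => /predU1P[->//|xy].
have [|c _ fxy] := @MVT R f df x y xy (fun z _ => dfE z).
  apply: derivable_within_continuous => z _.
  exact: (@ex_derive _ _ _ _ _ _ _ (dfE z)).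
by rewrite -subr_ge0 fxy mulr_ge0// subr_ge0 ltW.
Qed.

Lemma eq_of_derive_eq f g df :
  (forall x, is_derive x (1 : R) f (df x)) ->
  (forall x, is_derive x (1 : R) g (df x)) -> forall x y, f x - g x = f y - g y.
Proof.
move=> fE gE x y; apply/eqP; rewrite eq_le.
wlog xy : x y / x <= y => [wl|].
  by have [/wl//|/ltW/wl] := leP x y; rewrite andbC.
apply/andP; split.
  apply: (@nondecreasing_of_derive_ge0 (f - g) (fun x => df x - df x)) => //.
  by move=> z; rewrite subrr.
rewrite -lerN2 !opprB.
apply: (@nondecreasing_of_derive_ge0 (g - f) (fun x => df x - df x)) => //.
by move=> z; rewrite subrr.
Qed.

End monotone_derivative.

(** * The Gaussian density *)

Section gaussian_density.
Context {R : realType}.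
Local Notation mu := (@lebesgue_measure R).
Implicit Types x : R.

Definition gpdf : R -> R := normal_pdf 0 1.
Local Notation p := gpdf.

Lemma gpdfE x : p x = normal_peak 1 * expR (- (x ^+ 2 / 2)).
Proof.
rewrite /p normal_pdfE ?oner_neq0// /normal_fun subr0 expr1n.
by rewrite mulNr.
Qed.

Lemma gpdf_gt0 x : 0 < p x.
Proof. by rewrite gpdfE mulr_gt0 ?expR_gt0// normal_peak_gt0 ?oner_neq0. Qed.

(** Only [pi >= 2] enters. The value 1/2 is what lets [product_bound] absorb its quadratic term. *)
Lemma normal_peak1_le : normal_peak 1 <= 2^-1 :> R.
Proof.
have pi0 : 0 <= pi *+ 2 :> R by rewrite mulrn_wge0// pi_ge0.
have pi1 : 0 < pi *+ 2 :> R by rewrite pmulrn_lgt0// pi_gt0.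
rewrite /normal_peak expr1n mul1r lef_pV2 ?posrE ?sqrtr_gt0//.
rewrite -[leLHS](@ger0_norm R)// -sqrtr_sqr ler_sqrt//.
by have := pi_ge2 R; rewrite mulr2n expr2; lra.
Qed.

(** Follows from [expR y >= 1 + y] and the bound on the peak. This polynomial decay is crude, but it
    sends an affine function times [p] to [0] at infinity, which is all the boundary terms
    require. *)
Lemma gpdf_decay x : p x <= (2 + x ^+ 2)^-1.
Proof.
have h : 0 < 1 + x ^+ 2 / 2 by rewrite ltr_pwDl// divr_ge0// sqr_ge0.
rewrite gpdfE expRN (le_trans (ler_wpM2r _ normal_peak1_le)) ?invr_ge0 ?expR_ge0//.
rewrite -invfM lef_pV2 ?posrE ?mulr_gt0 ?expR_gt0 ?ltr_pwDl ?sqr_ge0//.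
have := expR_ge1Dx (x ^+ 2 / 2); lra.
Qed.

Lemma gpdf_le x : p x <= 2^-1.
Proof.
apply: le_trans (gpdf_decay x) _; rewrite lef_pV2 ?posrE// ?ltr_pwDl ?sqr_ge0//.
by rewrite lerDl sqr_ge0.
Qed.

Lemma gpdfN x : p (- x) = p x.
Proof. by rewrite !gpdfE sqrrN. Qed.

Global Instance is_derive_gpdf x : is_derive x (1 : R) p (- x * p x).
Proof.
have -> : p = fun x => normal_peak 1 * expR (- (x ^+ 2 / 2)).
  by apply/funext => y; rewrite gpdfE.
apply: is_derive_eq.
rewrite /GRing.scale/=. by field.
Qed.

Lemma gpdf_continuous : continuous p.
Proof. by apply: continuous_normal_pdf; rewrite oner_neq0. Qed.


(** Phrased with the density and Lebesgue measure, so that the fundamental theorem of calculus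
    applies to the half-line integrals. *)
Definition gintegrable (g : R -> R) :=
  mu.-integrable [set: R] (EFin \o (fun t => g t * p t)).

Definition lower_int (g : R -> R) x := \int[mu]_(t in `]-oo, x]) (g t * p t).
Definition upper_int (g : R -> R) x := \int[mu]_(t in `]x, +oo[) (g t * p t).

Lemma gintegrable_itv g (i : interval R) : gintegrable g ->
  mu.-integrable [set` i] (EFin \o (fun t => g t * p t)).
Proof. by move=> gi; apply: integrableS gi. Qed.

Lemma is_derive_lower_int g x : continuous g -> gintegrable g ->
  is_derive x (1 : R) (lower_int g) (g x * p x).
Proof.
move=> cg gi.
(* The right end [x + 1] only serves to make [x] an interior point. *)
have [||||h1 h2] := @continuous_FTC1 R (fun t => g t * p t) -oo%O x (x + 1).
- by rewrite ltrDl.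
- exact: gintegrable_itv.
- by rewrite ltNyr.
- by apply: cvgM; [exact: cg|exact: gpdf_continuous].
by split; [exact: h1|rewrite -derive1E; exact: h2].
Qed.

Lemma lower_int_upper_int g x : gintegrable g ->
  lower_int g x + upper_int g x = \int[mu]_t (g t * p t).
Proof.
move=> gi; rewrite /lower_int /upper_int -Rintegral_setU//=.
- by congr Rintegral; rewrite -setCitvl setUv.
- by rewrite -setCitvl setUv.
- by rewrite -setCitvl; apply/disj_setPCl.
Qed.

Lemma gpdf_cvgy : p x @[x --> +oo] --> (0 : R).
Proof.
apply/cvgrPdist_le => e e0; near=> x.
rewrite sub0r normrN gtr0_norm ?gpdf_gt0// (le_trans (gpdf_decay x))//.
have x0 : 1 <= x by near: x; exact: nbhs_pinfty_ge.
have xe : e^-1 <= x by near: x; apply: nbhs_pinfty_ge; rewrite num_real.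
rewrite -[leRHS]invrK lef_pV2 ?posrE ?invr_gt0 ?ltr_pwDl ?sqr_ge0//.
rewrite (le_trans xe)// expr2; nra.
Unshelve. all: by end_near. Qed.

Let cidp : continuous (fun t : R => t * p t).
Proof. by move=> x; apply: cvgM; [exact: cvg_id|exact: gpdf_continuous]. Qed.

Let int_pos : (\int[mu]_(x in `[0%R, +oo[) (x * p x)%:E = (p 0)%:E)%E.
Proof.
rewrite (@ge0_continuous_FTC2y R (fun x => x * p x) (fun x => - p x) 0 0).
- by rewrite -EFinB sub0r opprK.
- by move=> x x0; rewrite mulr_ge0// ltW// gpdf_gt0.
- exact: continuous_subspaceT.
- by rewrite -oppr0; apply: cvgN; exact: gpdf_cvgy.
- by move=> x _; apply: derivableN; exact: ex_derive.
- by apply: cvgN; apply: cvg_at_right_filter; exact: gpdf_continuous.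
- by move=> x _; rewrite derive1E deriveN ?derive_val ?mulNr ?opprK//.
Qed.

Lemma gintegrable_norm_id : gintegrable (fun t : R => `|t|).
Proof.
have cnp : continuous (fun t : R => `|t| * p t).
  by move=> x; apply: cvgM; [exact: norm_continuous|exact: gpdf_continuous].
apply/integrableP; split.
  by apply/measurable_EFinP; apply: continuous_measurable_fun; exact: cnp.
under eq_integral do rewrite /= normrM normr_id (gtr0_norm (gpdf_gt0 _)).
rewrite (@ge0_symfun_integralT R (fun x => `|x| * p x)) //.
- rewrite -set_itvcy.
  have -> : (\int[mu]_(x in `[0%R, +oo[) (`|x| * p x)%:E = (p 0)%:E)%E.
    rewrite -int_pos; apply: eq_integral => x.
    by rewrite inE/= in_itv/= andbT => x0; rewrite ger0_norm.
  by rewrite -EFinM ltry.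
- by move=> x; rewrite mulr_ge0// ltW// gpdf_gt0.
- by move=> x /=; rewrite normrN gpdfN.
Qed.

Lemma gintegrable_id : gintegrable id.
Proof.
apply: le_integrable gintegrable_norm_id => //.
  by apply/measurable_EFinP; apply: continuous_measurable_fun; exact: cidp.
by move=> t _ /=; rewrite lee_fin !normrM normr_id.
Qed.

(** Both sides have derivative [x * p x]; the constant is fixed at [0], where the reflection t -> -t
    reduces the integral to [int_pos]. *)
Lemma lower_int_id x : lower_int id x = - p x.
Proof.
have h0 : lower_int id 0 = - p 0.
  rewrite /lower_int /Rintegral -[in X in `]-oo, X]]oppr0.
  under eq_integral do rewrite -[X in X%:E]opprK -mulNr EFinN.
  rewrite (@integral_ge0N _ _ _ mu _ (fun x => (- x * p x)%:E)); last first.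
    move=> y/=; rewrite oppr0 in_itv/= => y0; rewrite lee_fin mulr_ge0 ?oppr_ge0//.
    exact/ltW/gpdf_gt0.
  rewrite ge0_integration_by_substitutionNy.
  - under eq_integral do rewrite /= opprK gpdfN.
    by rewrite int_pos.
  - by apply: continuous_subspaceT => y; apply: cvgM;
      [apply: cvgN; exact: cvg_id|exact: gpdf_continuous].
  - move=> y; rewrite in_itv/= oppr0 => y0.
    by rewrite mulr_ge0 ?(ltW (gpdf_gt0 _))// oppr_ge0 ltW.
have := @eq_of_derive_eq R (lower_int id) (fun y => - p y) (fun y => y * p y)
  _ _ x 0.
rewrite h0 subrr => h; apply/eqP; rewrite -subr_eq0; apply/eqP/h => y.
  by apply: is_derive_lower_int; [by move=> z; exact: cvg_id|exact: gintegrable_id].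
have -> : y * p y = - (- y * p y) by rewrite mulNr opprK.
exact: is_deriveN.
Qed.

Lemma upper_int_id x : upper_int id x = p x.
Proof.
have /eqP := lower_int_upper_int 0 gintegrable_id.
rewrite -(lower_int_upper_int x gintegrable_id) !lower_int_id.
have -> : upper_int id 0 = p 0.
  rewrite /upper_int Rintegral_itv_obnd_cbnd; first by rewrite /Rintegral int_pos.
  by apply: gintegrable_itv; exact: gintegrable_id.
by rewrite addNr eq_sym addrC subr_eq0 => /eqP.
Qed.

Lemma gintegrable_cst (k : R) : gintegrable (cst k).
Proof.
rewrite /gintegrable.
have -> : EFin \o (fun t => cst k t * p t) = (fun t => k%:E * (p t)%:E)%E by [].
by apply: integrableZl => //; exact: integrable_normal_pdf.
Qed.

Lemma integral_gpdf : \int[mu]_t p t = 1.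
Proof. by rewrite /Rintegral integral_normal_pdf. Qed.

End gaussian_density.

(** * Mills-type inequalities *)

Section gaussian_half_line_integrals.
Context {R : realType}.
Local Notation mu := (@lebesgue_measure R).
Local Notation p := (@gpdf R).
Implicit Types (x : R) (g h : R -> R).

Lemma gintegrable_lin (a b : R) g h : gintegrable g -> gintegrable h ->
  gintegrable (fun t => a * g t + b * h t).
Proof.
move=> gi hi; rewrite /gintegrable.
rewrite (_ : _ \o _ = (fun t => a%:E * (g t * p t)%:E + b%:E * (h t * p t)%:E)%E).
  by apply: integrableD => //; apply: integrableZl.
by apply/funext => t; rewrite /= -!EFinM -EFinD; congr EFin; ring.
Qed.

Lemma Rintegral_gpdf_lin (D : set (measurableTypeR R)) (a b : R) g h : measurable D ->
  gintegrable g -> gintegrable h ->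
  \int[mu]_(t in D) ((a * g t + b * h t) * p t) =
  a * \int[mu]_(t in D) (g t * p t) + b * \int[mu]_(t in D) (h t * p t).
Proof.
move=> mD gi hi.
have gD : mu.-integrable D (EFin \o (fun t => g t * p t)) by exact: integrableS gi.
have hD : mu.-integrable D (EFin \o (fun t => h t * p t)) by exact: integrableS hi.
have ZD (c : R) (k : R -> R) : mu.-integrable D (EFin \o k) ->
    mu.-integrable D (EFin \o (fun t => c * k t)).
  move=> ki; rewrite (_ : EFin \o _ = (fun t => c%:E * (EFin \o k) t)%E)//.
  exact: integrableZl.
rewrite -!RintegralZl// -RintegralD//; [|exact: ZD..].
by apply: eq_Rintegral => t _; ring.
Qed.

Lemma le_norm_Rintegral_gpdf (D : set (measurableTypeR R)) g h : measurable D ->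
  gintegrable g -> gintegrable h -> (forall t, D t -> `|g t| <= h t) ->
  `|\int[mu]_(t in D) (g t * p t)| <= \int[mu]_(t in D) (h t * p t).
Proof.
move=> mD gi hi gh.
have gD : mu.-integrable D (EFin \o (fun t => g t * p t)) by exact: integrableS gi.
have hD : mu.-integrable D (EFin \o (fun t => h t * p t)) by exact: integrableS hi.
rewrite (le_trans (le_normr_Rintegral mD gD))//; apply: le_Rintegral => //.
  exact: integrable_abse gD.
move=> t Dt /=.
by rewrite normrM (gtr0_norm (gpdf_gt0 _)) ler_wpM2r ?gh// ltW// gpdf_gt0.
Qed.

Lemma le_Rintegral_gpdf (D : set (measurableTypeR R)) g h : measurable D ->
  gintegrable g -> gintegrable h -> (forall t, D t -> g t <= h t) ->
  \int[mu]_(t in D) (g t * p t) <= \int[mu]_(t in D) (h t * p t).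
Proof.
move=> mD gi hi gh; apply: le_Rintegral => //.
- exact: integrableS gi.
- exact: integrableS hi.
- by move=> t Dt; rewrite ler_wpM2r ?gh// ltW// gpdf_gt0.
Qed.

Lemma lip_continuous g (k : R) :
  (forall x y, `|g x - g y| <= k * `|x - y|) -> continuous g.
Proof.
move=> gk x; apply/cvgrPdist_le => e e0; near=> y.
(* [|k| + 1] is positive whatever [k] is, so dividing by it needs no case distinction. *)
have k0 : 0 < `|k| + 1 by rewrite ltr_wpDl.
apply: (le_trans (gk _ _)).
rewrite (@le_trans _ _ ((`|k| + 1) * `|x - y|))//.
  by rewrite ler_wpM2r// ler_wpDr// ler_norm.
rewrite mulrC -ler_pdivlMr//.
by near: y; apply: cvgr_dist_le; [exact: cvg_id|rewrite divr_gt0].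
Unshelve. all: by end_near. Qed.

Lemma gintegrable_lip g (k : R) :
  (forall x y, `|g x - g y| <= k * `|x - y|) -> gintegrable g.
Proof.
move=> gk.
have mg : measurable_fun [set: R] (fun t => g t * p t).
  apply: continuous_measurable_fun => x; apply: cvgM.
    exact: (lip_continuous gk).
  exact: gpdf_continuous.
have hi : gintegrable (fun t => `|g 0| + k * `|t|).
  have := gintegrable_lin 1 k (gintegrable_cst `|g 0|)
    (@gintegrable_norm_id R).
  by under eq_fun do rewrite mul1r.
apply: le_integrable hi => //; first exact/measurable_EFinP.
move=> t _ /=; rewrite lee_fin !normrM ler_wpM2r//.
have := gk t 0; rewrite subr0 => gk0.
rewrite [leRHS]ger0_norm; last by rewrite addr_ge0// (le_trans _ gk0).
rewrite -(subrK (g 0) (g t)) (le_trans (ler_normD _ _))// addrC lerD2l.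
exact: gk0.
Qed.


Lemma lower_int_cst1_ge0 x : 0 <= lower_int (cst 1) x.
Proof. by apply: Rintegral_ge0 => t _; rewrite mul1r ltW// gpdf_gt0. Qed.

Lemma upper_int_cst1_ge0 x : 0 <= upper_int (cst 1) x.
Proof. by apply: Rintegral_ge0 => t _; rewrite mul1r ltW// gpdf_gt0. Qed.

Lemma lower_int_upper_int_cst1 x :
  lower_int (cst 1) x + upper_int (cst 1) x = 1.
Proof.
rewrite lower_int_upper_int; last exact: gintegrable_cst.
by under eq_Rintegral do rewrite mul1r; rewrite integral_gpdf.
Qed.

Local Notation L := (lower_int (cst 1)).
Local Notation U := (upper_int (cst 1)).

Let gpdf_tail (k t : R) : 0 <= k -> 1 <= `|t| ->
  (`|t| + k) * p t <= (1 + k) / `|t|.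
Proof.
move=> k0 t1; have t0 : 0 < `|t| by rewrite (lt_le_trans _ t1).
have := gpdf_decay t; rewrite -real_normK ?num_real//; move: t1 t0; set r := `|t| => t1 t0.
move=> /(ler_wpM2l (addr_ge0 (ltW t0) k0)) /le_trans; apply.
rewrite ler_pdivrMr ?ltr_pwDl ?sqr_ge0// mulrAC ler_pdivlMr//.
have r1 : 0 <= r - 1 by rewrite subr_ge0.
have := mulr_ge0 k0 (mulr_ge0 (ltW t0) r1); lra.
Qed.

(* The derivative of this function of x is (x - c) ^+ 2 * gpdf x. *)
Let birnbaum (c x : R) := - x * p x + 2 * c * p x + (1 + c ^+ 2) * L x.

Let birnbaum_nd (c : R) : {homo birnbaum c : x y / x <= y}.
Proof.
apply: (@nondecreasing_of_derive_ge0 R _ (fun x => (x - c) ^+ 2 * p x)) => x.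
  have c1 : continuous (cst 1 : R -> R) by move=> y; exact: cvg_cst.
  have dL := is_derive_lower_int x c1 (gintegrable_cst 1).
  rewrite /birnbaum; apply: is_derive_eq.
  by rewrite /GRing.scale/=; ring.
by rewrite mulr_ge0 ?sqr_ge0// ltW// gpdf_gt0.
Qed.

Let birnbaum_tail (c x : R) : 1 <= `|x| ->
  `|- x * p x + 2 * c * p x| <= (1 + 2 * `|c|) / `|x|.
Proof.
move=> x1; rewrite -mulrDl normrM (gtr0_norm (gpdf_gt0 _)).
apply: le_trans (gpdf_tail _ x1); last by rewrite mulr_ge0.
rewrite ler_wpM2r ?(ltW (gpdf_gt0 _))// (le_trans (ler_normD _ _))//.
by rewrite normrN normrM (@ger0_norm _ 2).
Qed.

(** Stands for the passage to the limit at infinity: a point beyond [|x|] where the boundary terms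
    of [birnbaum c] are at most [e]. *)
Let far (c x e : R) : 0 < e -> exists t, [/\ 1 <= t, `|x| <= t &
  (1 + 2 * `|c|) / t <= e].
Proof.
move=> e0; have c0 : 0 <= 1 + 2 * `|c| by rewrite addr_ge0// mulr_ge0.
exists (1 + `|x| + (1 + 2 * `|c|) / e).
have h0 : 0 <= (1 + 2 * `|c|) / e by rewrite divr_ge0// ltW.
have x0 := normr_ge0 x.
split; [lra|lra|].
rewrite ler_pdivrMr; last lra.
rewrite mulrDr [e * (_ / e)]mulrC divfK ?gt_eqF// lerDr mulr_ge0//; first exact: ltW.
Qed.

(* Both bounds below say that the integral of (t - c) ^+ 2 * gpdf t over a
   half-line is nonnegative. *)
Lemma lower_int_quadratic (c x : R) :
  0 <= - x * p x + 2 * c * p x + (1 + c ^+ 2) * L x.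
Proof.
(* [birnbaum c] increases from [- t] to [x]; at [- t] its boundary terms are at least [- e] and its
   multiple of [L] is nonnegative. *)
apply/ler_addgt0Pr => e e0; have [t [t1 xt te]] := far c x e0.
have nt : `|- t| = t by rewrite normrN ger0_norm// (le_trans _ t1).
have := @birnbaum_tail c (- t); rewrite nt => /(_ t1) /le_trans /(_ te).
rewrite ler_norml => /andP[h _].
have : birnbaum c (- t) <= birnbaum c x.
  by apply: birnbaum_nd; rewrite lerNl (le_trans _ xt)// -normrN ler_norm.
rewrite /birnbaum => h'.
have : 0 <= (1 + c ^+ 2) * L (- t).
  by rewrite mulr_ge0 ?lower_int_cst1_ge0// addr_ge0// sqr_ge0.
lra.
Qed.

Lemma upper_int_quadratic (c x : R) :
  0 <= x * p x - 2 * c * p x + (1 + c ^+ 2) * U x.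
Proof.
apply/ler_addgt0Pr => e e0; have [t [t1 xt te]] := far c x e0.
have nt : `|t| = t by rewrite ger0_norm// (le_trans _ t1).
have := @birnbaum_tail c t; rewrite nt => /(_ t1) /le_trans /(_ te).
rewrite ler_norml => /andP[_ h].
have : birnbaum c x <= birnbaum c t.
  by apply: birnbaum_nd; rewrite (le_trans _ xt)// ler_norm.
rewrite /birnbaum => h'.
have : 0 <= (1 + c ^+ 2) * U t.
  by rewrite mulr_ge0 ?upper_int_cst1_ge0// addr_ge0// sqr_ge0.
have -> : U t = 1 - L t by have := lower_int_upper_int_cst1 t; lra.
have -> : U x = 1 - L x by have := lower_int_upper_int_cst1 x; lra.
lra.
Qed.

(** The quadratic bound at [c = x]. Written without division, it holds for [x] of either sign. *)
Lemma mills_upper x : x * p x <= (1 + x ^+ 2) * U x.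
Proof. by have := upper_int_quadratic x x; lra. Qed.

Lemma mills_lower x : - x * p x <= (1 + x ^+ 2) * L x.
Proof. by have := lower_int_quadratic x x; lra. Qed.

(** For [u > 0] the quadratic is evaluated at its minimum [c = b / u]. For [u = 0] it is affine with
    nonzero slope, so it cannot stay nonnegative. *)
Let discriminant (a b u : R) : 0 <= u -> 0 < b ->
  (forall c, 0 <= a - 2 * c * b + c ^+ 2 * u) -> b ^+ 2 <= a * u.
Proof.
rewrite le_eqVlt => /predU1P[<- b0 h|u0 b0 h].
  (* At this point the affine function equals [a - 2 * (|a| + 1)], which is negative. *)
  have := h ((`|a| + 1) / b).
  rewrite mulr0 addr0 -mulrA divfK ?gt_eqF//.
  by have := ler_norm a; have := normr_ge0 a; lra.
rewrite -subr_ge0 (_ : _ - _ = (a - 2 * (b / u) * b + (b / u) ^+ 2 * u) * u).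
  by rewrite mulr_ge0// ltW.
by field; rewrite gt_eqF.
Qed.

(** This is Cauchy-Schwarz for the functions 1 and t on []x, +oo[], where the Gaussian moments of
    order 0, 1 and 2 are [U x], [p x] and [x * p x + U x]. *)
Lemma birnbaum_upper x : p x ^+ 2 <= (x * p x + U x) * U x.
Proof.
apply: discriminant; [exact: upper_int_cst1_ge0|exact: gpdf_gt0|] => c.
by have := upper_int_quadratic c x; lra.
Qed.

Lemma birnbaum_lower x : p x ^+ 2 <= (- x * p x + L x) * L x.
Proof.
apply: discriminant; [exact: lower_int_cst1_ge0|exact: gpdf_gt0|] => c.
by have := lower_int_quadratic (- c) x; rewrite sqrrN; lra.
Qed.

Lemma lower_int_dist x : lower_int (fun t => `|x - t|) x = x * L x + p x.
Proof.
rewrite -[p x]opprK -lower_int_id -mulN1r.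
rewrite -Rintegral_gpdf_lin//; [|exact: gintegrable_cst|exact: gintegrable_id].
apply: eq_Rintegral => t; rewrite inE/= in_itv/= => tx.
by rewrite ger0_norm ?subr_ge0//; ring.
Qed.

Lemma upper_int_dist x : upper_int (fun t => `|x - t|) x = p x - x * U x.
Proof.
rewrite -[in RHS]upper_int_id -mulNr -[upper_int id x]mul1r.
rewrite -Rintegral_gpdf_lin//; [|exact: gintegrable_id|exact: gintegrable_cst].
apply: eq_Rintegral => t; rewrite inE/= in_itv/= andbT => tx.
by rewrite distrC ger0_norm ?subr_ge0 ?(ltW tx)//; ring.
Qed.

(** To be read with [q = p x], [z = x], [u = U x], so that [w] is E(N - x)^+ and [w + z] is E(N -
    x)^-. The Birnbaum hypothesis becomes q w <= u^2; with 4 q w <= (q + w)^2 it gives [key].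
    Multiplying [key] by z u = q - w and cancelling [u] bounds 2 w z q by q^2 - w^2, and q <= 1/2
    bounds the remaining 2 q w^2 by w^2. *)
Let product_bound (q z u : R) : 0 < q -> q <= 2^-1 -> 0 <= z -> 0 <= u ->
  0 <= q - z * u -> q ^+ 2 <= (z * q + u) * u ->
  2 * ((q - z * u) * (q - z * u + z)) <= q.
Proof.
move=> q0 q2 z0 u0; set w := q - z * u => w0 h.
have zu : z * u = q - w by rewrite /w; ring.
have zu0 : 0 <= q - w by rewrite -zu mulr_ge0.
have qw : q * w <= u ^+ 2.
  by rewrite /w; move: h; rewrite !expr2 => h; nra.
have up : 0 < u.
  rewrite lt0r u0 andbT; apply/eqP => uE; move: qw.
  by rewrite /w uE mulr0 subr0 expr0n/= leNgt mulr_gt0.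
clearbody w; have key : 2 * w * q <= (q + w) * u.
  rewrite -(@ler_pXn2r _ 2)// ?nnegrE ?mulr_ge0 ?addr_ge0// ?(ltW q0)//.
  rewrite [leRHS]exprMn (@le_trans _ _ ((q + w) ^+ 2 * (q * w)))//.
    have qw0 : 0 <= q * w by rewrite mulr_ge0// ltW.
    have := mulr_ge0 qw0 (sqr_ge0 (q - w)); lra.
  by rewrite ler_wpM2l ?sqr_ge0.
have key2 : 2 * w * z * q <= q ^+ 2 - w ^+ 2.
  rewrite -(ler_pM2r up) (_ : _ * u = (q - w) * (2 * w * q)); last first.
    by rewrite -zu; ring.
  rewrite [leRHS](_ : _ = (q - w) * ((q + w) * u)); last by ring.
  exact: ler_wpM2l.
rewrite -(ler_pM2r q0).
have : 2 * q * w ^+ 2 <= w ^+ 2 by rewrite ler_piMl ?sqr_ge0//; lra.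
lra.
Qed.

(** [product_bound] asks for [z >= 0]. When [x < 0] the two half-lines exchange roles, with
    [z = - x] and the lower mass in place of the upper one. *)
Lemma half_line_dist_product x :
  2 * (lower_int (fun t => `|x - t|) x * upper_int (fun t => `|x - t|) x) <= p x.
Proof.
have UE : U x = 1 - L x by have := lower_int_upper_int_cst1 x; lra.
have u0 : 0 <= upper_int (fun t => `|x - t|) x.
  by apply: Rintegral_ge0 => t _; rewrite mulr_ge0// ltW// gpdf_gt0.
have v0 : 0 <= lower_int (fun t => `|x - t|) x.
  by apply: Rintegral_ge0 => t _; rewrite mulr_ge0// ltW// gpdf_gt0.
move: u0 v0; rewrite lower_int_dist upper_int_dist => u0 v0.
have [x0|x0] := leP 0 x.
  have := product_bound (gpdf_gt0 x) (gpdf_le x) x0 (upper_int_cst1_ge0 x) u0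
    (birnbaum_upper x).
  rewrite (_ : p x - x * U x + x = x * L x + p x).
    by rewrite [X in 2 * X]mulrC.
  by rewrite UE; ring.
have v0' : 0 <= p x - - x * L x by rewrite mulNr opprK addrC.
have x0' : 0 <= - x by rewrite oppr_ge0 ltW.
have := product_bound (gpdf_gt0 x) (gpdf_le x) x0' (lower_int_cst1_ge0 x) v0'
  (birnbaum_lower x).
rewrite (_ : p x - - x * L x + - x = p x - x * U x).
  by rewrite (_ : p x - - x * L x = x * L x + p x)//; ring.
by rewrite UE; ring.
Qed.

End gaussian_half_line_integrals.

(** * Stein's equation *)

Section stein_equation.
Context {R : realType}.
Local Notation mu := (@lebesgue_measure R).
Local Notation p := (@gpdf R).
Local Notation L := (lower_int (cst 1)).
Local Notation U := (upper_int (cst 1)).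
Implicit Types (x : R) (g h : R -> R).

Lemma gpdf_neq0 x : p x != 0.
Proof. by rewrite gt_eqF// gpdf_gt0. Qed.

(** Since p' = -x p, the quotient solves f' = x f + g, which is Stein's equation with right-hand
    side [g]. *)
Lemma is_derive_lower_int_div g x : continuous g -> gintegrable g ->
  is_derive x (1 : R) (fun t => lower_int g t / p t)
    (x * (lower_int g x / p x) + g x).
Proof.
move=> cg gi; have dg := is_derive_lower_int x cg gi.
have px := gpdf_neq0 x.
have dV : is_derive x (1 : R) (fun t => (p t)^-1) (x / p x).
  have dp : derivable p x 1 by exact: ex_derive.
  split; first exact: derivableV.
  by rewrite deriveV// derive_val /GRing.scale/=; field.
apply: is_derive_eq.
by rewrite /GRing.scale/=; field.
Qed.

(* Used with [g] equal to [id] plus or minus the centered test function: it makes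
   [x * f x] 1-Lipschitz, hence [f'] 2-Lipschitz, without differentiating [phi]. *)
Lemma nonincreasing_mul_stein g : continuous g -> gintegrable g ->
  \int[mu]_t (g t * p t) = 0 -> {homo g : x y / x <= y} ->
  {homo (fun x => - (x * (lower_int g x / p x))) : x y / x <= y}.
Proof.
move=> cg gi g0 ndg.
pose f x := lower_int g x / p x.
apply: (@nondecreasing_of_derive_ge0 R _ (fun x => - (f x + x * (x * f x + g x)))).
  move=> x; have df := is_derive_lower_int_div x cg gi.
  by apply: is_derive_eq; rewrite /GRing.scale/= /f; ring.
move=> x; rewrite oppr_ge0 -(pmulr_lle0 _ (gpdf_gt0 x)).
rewrite (_ : _ * p x = (1 + x ^+ 2) * lower_int g x + x * p x * g x); last first.
  by rewrite /f; field; exact: gpdf_neq0.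
(* Monotonicity compares [g] with the constant [g x] on either side of [x]. *)
have low : lower_int g x <= g x * L x.
  rewrite -[g x * L x]addr0 -(mul0r (L x)).
  rewrite -Rintegral_gpdf_lin//; [|exact: gintegrable_cst..].
  apply: le_Rintegral_gpdf => //.
    by apply: gintegrable_lin; exact: gintegrable_cst.
  by move=> t; rewrite /= in_itv/= mulr1 mul0r addr0; exact: ndg.
have upp : g x * U x <= upper_int g x.
  rewrite -[g x * U x]addr0 -(mul0r (U x)).
  rewrite -Rintegral_gpdf_lin//; [|exact: gintegrable_cst..].
  apply: le_Rintegral_gpdf => //.
    by apply: gintegrable_lin; exact: gintegrable_cst.
  by move=> t; rewrite /= in_itv/= andbT mulr1 mul0r addr0 => /ltW; exact: ndg.
have sum0 := lower_int_upper_int x gi.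
have x2 : 0 <= 1 + x ^+ 2 by rewrite addr_ge0// sqr_ge0.
(* The sign of [g x] decides which Mills inequality applies. For [g x >= 0], the zero mean first
   turns the lower integral into minus the upper one. *)
have [gx|/ltW gx] := leP 0 (g x).
  have := ler_wpM2l gx (mills_upper x).
  have : (1 + x ^+ 2) * lower_int g x <= (1 + x ^+ 2) * - (g x * U x).
    by apply: ler_wpM2l => //; lra.
  lra.
have := ler_wnM2l gx (mills_lower x).
have := ler_wpM2l x2 low.
lra.
Qed.

Lemma stein_solution (phi : R -> R) : Lip 1 phi ->
  let m := \int[mu]_t (phi t * p t) in
  exists f f' : R -> R, [/\ forall x, is_derive x (1 : R) f (f' x),
    forall x, f' x = x * f x + (phi x - m),
    forall x, `|f' x| <= 1 &
    forall x y, `|f' x - f' y| <= 2 * `|x - y|].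
Proof.
move=> lphi m.
have cphi : continuous phi := lip_continuous lphi.
have iphi : gintegrable phi := gintegrable_lip lphi.
pose psi t := phi t - m.
have lpsi : Lip 1 psi by move=> x y; rewrite /psi opprB addrA subrK; exact: lphi.
have cpsi : continuous psi := lip_continuous lpsi.
have ipsi : gintegrable psi := gintegrable_lip lpsi.
have psi0 : \int[mu]_t (psi t * p t) = 0.
  transitivity (\int[mu]_t ((1 * phi t + - m * 1) * p t)).
    by apply: eq_Rintegral => t _; rewrite /psi mul1r mulr1.
  rewrite Rintegral_gpdf_lin//; last exact: (gintegrable_cst 1).
  under [X in _ + _ * X]eq_Rintegral do rewrite mul1r.
  by rewrite integral_gpdf mul1r mulr1 subrr.
pose f x := lower_int psi x / p x.
exists f, (fun x => x * f x + psi x); split => //.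
- by move=> x; exact: is_derive_lower_int_div.
- move=> x; rewrite -(ler_pM2r (gpdf_gt0 x)) mul1r.
  rewrite -[X in `|_| * X](gtr0_norm (gpdf_gt0 x)) -normrM.
  (* Recentring at [x] makes the Lipschitz condition usable: [|eta t| <= |x - t|]. *)
  pose eta t := phi t - phi x.
  have ieta : gintegrable eta.
    apply: (@gintegrable_lip R _ 1) => s t.
    by rewrite /eta opprB addrA subrK; exact: lphi.
  have etaE t : psi t = 1 * eta t + psi x * 1 by rewrite /psi /eta; ring.
  have lowE : lower_int psi x = lower_int eta x + psi x * L x.
    rewrite -[lower_int eta x]mul1r -Rintegral_gpdf_lin//; last exact: gintegrable_cst.
    by apply: eq_Rintegral => t _; rewrite etaE.
  have uppE : upper_int psi x = upper_int eta x + psi x * U x.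
    rewrite -[upper_int eta x]mul1r -Rintegral_gpdf_lin//; last exact: gintegrable_cst.
    by apply: eq_Rintegral => t _; rewrite etaE.
  have := lower_int_upper_int x ipsi; rewrite psi0 lowE uppE => sum0.
  have UE : U x = 1 - L x by have := lower_int_upper_int_cst1 x; lra.
  have psix : psi x = - (lower_int eta x + upper_int eta x).
    by move: sum0; rewrite UE; lra.
  (* After eliminating [psi x] by the zero mean, each product is at most the product of the two
     half-line distances; this accounts for the factor 2 in [half_line_dist_product]. *)
  have -> : (x * f x + psi x) * p x =
      - (lower_int eta x * upper_int (fun t => `|x - t|) x +
         upper_int eta x * lower_int (fun t => `|x - t|) x).
    rewrite lower_int_dist upper_int_dist mulrDl /f -mulrA divfK ?gpdf_neq0//.
    by rewrite lowE psix UE; ring.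
  have idist : gintegrable (fun t => `|x - t|).
    apply: (@gintegrable_lip R _ 1) => s t; rewrite mul1r.
    rewrite (le_trans (ler_dist_dist _ _))// (_ : x - s - _ = t - s) 1?distrC//.
    by ring.
  have hA : `|lower_int eta x| <= lower_int (fun t => `|x - t|) x.
    apply: le_norm_Rintegral_gpdf => // t _.
    by rewrite /eta distrC (le_trans (lphi _ _))// mul1r.
  have hB : `|upper_int eta x| <= upper_int (fun t => `|x - t|) x.
    apply: le_norm_Rintegral_gpdf => // t _.
    by rewrite /eta distrC (le_trans (lphi _ _))// mul1r.
  apply: le_trans (half_line_dist_product x).
  rewrite normrN (le_trans (ler_normD _ _))// !normrM.
  have v0 : 0 <= lower_int (fun t => `|x - t|) x := le_trans (normr_ge0 _) hA.
  have u0 : 0 <= upper_int (fun t => `|x - t|) x := le_trans (normr_ge0 _) hB.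
  rewrite !(ger0_norm u0) !(ger0_norm v0).
  have := ler_wpM2r u0 hA; have := ler_wpM2r v0 hB; lra.
(* The term [id] of [g] contributes [lower_int id = - p], hence the summand [x]. The signs [s = 1]
   and [s = -1] bound the increments of [x * f x] from above and from below. *)
- have sgn (s : R) : `|s| = 1 -> {homo (fun x => x - s * (x * f x)) : x y / x <= y}.
    move=> s1.
    pose g t := 1 * t + s * psi t.
    have ig : gintegrable g by apply: gintegrable_lin => //; exact: gintegrable_id.
    have cg : continuous g.
      move=> t; apply: cvgD; first by apply: cvgM; [exact: cvg_cst|exact: cvg_id].
      by apply: cvgM; [exact: cvg_cst|exact: cpsi].
    have g0 : \int[mu]_t (g t * p t) = 0.
      rewrite Rintegral_gpdf_lin// ?psi0; last exact: gintegrable_id.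
      rewrite -(lower_int_upper_int 0 (@gintegrable_id R)).
      by rewrite lower_int_id upper_int_id addNr !mulr0 addr0.
    have ndg : {homo g : x y / x <= y}.
      move=> x y xy; rewrite -subr_ge0 /g.
      have : `|s * (psi x - psi y)| <= y - x.
        rewrite normrM s1 mul1r (le_trans (lpsi _ _))// mul1r distrC.
        by rewrite ger0_norm// subr_ge0.
      by rewrite ler_norml => /andP[]; lra.
    move=> x y xy; have := nonincreasing_mul_stein cg ig g0 ndg xy.
    have E z : - (z * (lower_int g z / p z)) = z - s * (z * f z).
      rewrite [lower_int g z]Rintegral_gpdf_lin//; last exact: gintegrable_id.
      rewrite -/(lower_int id z) lower_int_id -/(lower_int psi z) /f.
      by field; exact: gpdf_neq0.
    by rewrite !E.
  have lxf x y : `|x * f x - y * f y| <= `|x - y|.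
    wlog xy : x y / x <= y => [wl|].
      have [/wl//|/ltW/wl] := leP x y.
      by rewrite distrC [X in _ <= X -> _]distrC.
    have s1 := sgn 1 (normr1 _) _ _ xy.
    have s2 := sgn (-1) (normrN1 _) _ _ xy.
    by rewrite [leRHS]distrC [leRHS]ger0_norm ?subr_ge0// ler_norml; lra.
  move=> x y; have -> : x * f x + psi x - (y * f y + psi y) =
    (x * f x - y * f y) + (psi x - psi y) by ring.
  rewrite (le_trans (ler_normD _ _))//; have := lxf x y; have := lpsi x y; lra.
Qed.

(** No second derivative is needed: the Lipschitz bound on f' gives [D'] the sign of [z - x], so [D]
    is minimal at [x], where it vanishes. The two signs of [s] give the two sides of the absolute
    value. *)
Lemma taylor2_le (f f' : R -> R) (k : R) :
  (forall x, is_derive x (1 : R) f (f' x)) ->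
  (forall x y, `|f' x - f' y| <= 2 * k * `|x - y|) ->
  forall x y, `|f y - f x - f' x * (y - x)| <= k * (y - x) ^+ 2.
Proof.
move=> df lf' x y.
have taylor (s : R) : `|s| = 1 ->
    s * (f y - f x - f' x * (y - x)) <= k * (y - x) ^+ 2.
  move=> s1.
  pose D z := k * (z - x) ^+ 2 - s * (f z - f x - f' x * (z - x)).
  pose D' z := 2 * k * (z - x) - s * (f' z - f' x).
  have dD z : is_derive z (1 : R) D (D' z).
    by apply: is_derive_eq; rewrite /GRing.scale/= /D'; ring.
  have cD a b : {within `[a, b], continuous D}.
    apply: derivable_within_continuous => z _.
    exact: (@ex_derive _ _ _ _ _ _ _ (dD z)).
  have Dx : D x = 0 by rewrite /D !subrr mulr0 subrr mulr0 subr0 expr0n mulr0.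
  have bD z : `|s * (f' z - f' x)| <= 2 * k * `|z - x|.
    by rewrite normrM s1 mul1r; exact: lf'.
  suff : 0 <= D y by rewrite /D subr_ge0.
  have [xy|yx|<-] := ltgtP x y; last by rewrite Dx.
  - have [//|c /[!in_itv]/= /andP[xc _]] := MVT xy (fun z _ => dD z).
    rewrite Dx subr0 => ->; rewrite mulr_ge0 ?subr_ge0 ?(ltW xy)//.
    have c0 : 0 < c - x by rewrite subr_gt0.
    have := bD c; rewrite (gtr0_norm c0) ler_norml /D' => /andP[_].
    lra.
  - have [//|c /[!in_itv]/= /andP[_ cx]] := MVT yx (fun z _ => dD z).
    rewrite Dx sub0r => /eqP; rewrite eqr_oppLR => /eqP ->.
    rewrite oppr_ge0 mulr_le0_ge0 ?subr_ge0 ?(ltW yx)//.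
    have c0 : c - x < 0 by rewrite subr_lt0.
    have := bD c; rewrite (ltr0_norm c0) ler_norml /D' => /andP[+ _].
    lra.
rewrite ler_norml; have := taylor 1 (normr1 _); have := taylor (-1) (normrN1 _).
by rewrite mulN1r mul1r => h1 h2; apply/andP; split => //; rewrite lerNl.
Qed.

Lemma lip_of_derive_le (f f' : R -> R) (k : R) :
  (forall x, is_derive x (1 : R) f (f' x)) -> (forall x, `|f' x| <= k) ->
  forall x y, `|f x - f y| <= k * `|x - y|.
Proof.
move=> df bf x y; wlog xy : x y / x <= y => [wl|].
  have [/wl//|/ltW/wl] := leP x y.
  by rewrite distrC [X in _ <= _ * X -> _]distrC.
have [|c _ E] := MVT_segment xy (fun z _ => df z).
  apply: derivable_within_continuous => z _.
  exact: (@ex_derive _ _ _ _ _ _ _ (df z)).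
by rewrite distrC [X in _ * X]distrC E normrM ler_wpM2r.
Qed.

End stein_equation.

(** * Integrals against the Gaussian measure *)

Section normal_prob_integral.
Context {R : realType}.
Local Notation mu := (@lebesgue_measure R).
Local Notation N := (@normal_prob R 0 1).

(** The Radon-Nikodym derivative of [N] and [gpdf] have the same integral over every measurable set,
    hence agree almost everywhere. *)
Lemma ge0_integral_normal_prob (g : measurableTypeR R -> \bar R) :
  measurable_fun [set: measurableTypeR R] g -> (forall x, 0 <= g x)%E ->
  (\int[N]_x g x = \int[mu]_x (g x * (gpdf x)%:E))%E.
Proof.
move=> mg g0.
have Nmu : N `<< mu := normal_prob_dominates 0 1.
rewrite -(Radon_Nikodym_SigmaFinite.change_of_variables Nmu)//.
have mRN : measurable_fun [set: measurableTypeR R]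
    (Radon_Nikodym_SigmaFinite.f N mu).
  exact: measurable_int (Radon_Nikodym_SigmaFinite.f_integrable Nmu).
have mp : measurable_fun [set: measurableTypeR R] (EFin \o @gpdf R).
  by apply/measurable_EFinP; exact: measurable_normal_pdf.
apply: ae_eq_integral => //; [exact: emeasurable_funM..|].
apply: ae_eqe_mul2l; apply: integral_ae_eq => //.
  exact: Radon_Nikodym_SigmaFinite.f_integrable.
by move=> E _ mE; rewrite -Radon_Nikodym_SigmaFinite.f_integral.
Qed.

Lemma integrable_normal_prob (g : R -> R) :
  measurable_fun [set: measurableTypeR R] g -> gintegrable g ->
  N.-integrable [set: measurableTypeR R] (EFin \o g).
Proof.
move=> mg gi; apply/integrableP; split; first exact/measurable_EFinP.
rewrite ge0_integral_normal_prob//; last first.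
  by apply: measurableT_comp => //; exact/measurable_EFinP.
move/integrableP : gi => [_]; apply: le_lt_trans.
rewrite (@eq_integral _ _ _ mu setT (fun t => `|(g t * gpdf t)%:E|%E))// => t _.
by rewrite /= normrM (gtr0_norm (gpdf_gt0 _)).
Qed.

Lemma integral_normal_prob (g : R -> R) :
  measurable_fun [set: measurableTypeR R] g -> gintegrable g ->
  (\int[N]_x (g x)%:E = (\int[mu]_t (g t * gpdf t))%:E)%E.
Proof.
move=> mg gi; have Ng := integrable_normal_prob mg gi.
rewrite /Rintegral fineK; last exact: integrable_fin_num gi.
rewrite [LHS]integralE [RHS]integralE; congr (_ - _)%E.
  rewrite ge0_integral_normal_prob//; last first.
    exact/measurable_funepos/measurable_EFinP.
  apply: eq_integral => t _.
  rewrite !funeposE/= -EFin_max -EFin_max -EFinM; congr EFin.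
  by rewrite maxr_pMl ?mul0r// ltW// gpdf_gt0.
rewrite ge0_integral_normal_prob//; last first.
  exact/measurable_funeneg/measurable_EFinP.
apply: eq_integral => t _.
rewrite !funenegE/= -EFin_max -EFin_max -EFinM; congr EFin.
by rewrite maxr_pMl ?mul0r ?mulNr// ltW// gpdf_gt0.
Qed.

(* [normal_prob] lives on [measurableTypeR R], which carries the same sets as
   [R] but another display, hence the detour through the identity. *)
Lemma integral_normal_prob_lip (phi : R -> R) : Lip 1 phi ->
  @integral _ R R N setT (EFin \o phi) = (\int[mu]_t (phi t * gpdf t))%:E.
Proof.
move=> lphi.
have cphi : continuous phi := lip_continuous lphi.
have iphi : gintegrable phi := gintegrable_lip lphi.
have mphi' : measurable_fun [set: measurableTypeR R] phi.
  exact: continuous_measurable_fun.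
have mphi : measurable_fun [set: R] (EFin \o phi) by exact/measurable_EFinP.
rewrite -integral_normal_prob//.
have mid : measurable_fun [set: measurableTypeR R] (id : measurableTypeR R -> R).
  by move=> _ Y mY; rewrite setTI.
have := @integral_pushforward _ _ (measurableTypeR R) R R id mid N setT
  (EFin \o phi) mphi.
by move=> /(_ (integrable_normal_prob mphi' iphi) measurableT).
Qed.

(** Collects what is used on the product space. Continuity of f' serves measurability there, and the
    remainder has coefficient 1 because f' is 2-Lipschitz. *)
Lemma stein_equation (phi : R -> R) : Lip 1 phi ->
  exists m, @integral _ R R N setT (EFin \o phi) = m%:E /\
  exists f f' : R -> R, [/\ forall x, f' x = x * f x + (phi x - m),
    forall x, `|f' x| <= 1,
    forall x y, `|f x - f y| <= `|x - y|,
    continuous f' &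
    forall x y, `|f y - f x - f' x * (y - x)| <= (y - x) ^+ 2].
Proof.
move=> lphi; exists (\int[mu]_t (phi t * gpdf t)).
split; first exact: integral_normal_prob_lip.
have [f [f' [df f'E bf' lf']]] := stein_solution lphi.
exists f, f'; split => //.
- by move=> x y; rewrite -[leRHS]mul1r; exact: lip_of_derive_le.
- exact: (@lip_continuous R _ 2).
- move=> x y; rewrite -[leRHS]mul1r; apply: taylor2_le => //.
  by move=> s t; rewrite mulr1; exact: lf'.
Qed.

End normal_prob_integral.

(** * Sums over a countable index set *)

Section countable_sums.
Context {R : realType} {A : countType}.
Implicit Types (D : set A) (S : {fset A}).
Local Open Scope ereal_scope.

(** Rewrites a sum over [A] as a series along the partial inverse of [pickle], with value [0] at
    integers that code no index. Measurability and exchange with the integral are then inherited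
    from series. *)
Lemma esum_nneseries D (f : A -> \bar R) : (forall a, 0 <= f a) ->
  \esum_(a in D) f a =
  \sum_(n <oo) oapp (fun a => if a \in D then f a else 0) 0 (pickle_inv n).
Proof.
move=> f0; rewrite esum_mkcond.
set h := fun a => if a \in D then f a else 0.
have h0 n : 0 <= oapp h 0 (@pickle_inv A n).
  by case: (pickle_inv n) => //= a; rewrite /h; case: ifP.
rewrite nneseries_esumT//.
transitivity (\esum_(n in choice.pickle @` [set: A]) oapp h 0 (@pickle_inv A n)).
  rewrite esum_image; last by move=> a b _ _; exact: (pcan_inj (@choice.pickleK A)).
  by apply: eq_esum => a _; rewrite pickleK_inv.
rewrite esum_mkcond; apply: eq_esum => n _; case: ifPn => // nA.
case E : (pickle_inv n) => [a|]//=; move: nA.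
rewrite mem_set//=; exists a => //.
by have := @pickle_invK A n; rewrite E.
Qed.

Lemma esum_fset_nneg S (f : A -> \bar R) : (forall a, 0 <= f a) ->
  \esum_(a in [set` S]) f a = \sum_(a <- S) f a.
Proof.
move=> f0; rewrite esum_fset//.
by rewrite fsbig_finite//= set_fsetK.
Qed.

Lemma esum_fsetID S (f : A -> \bar R) : (forall a, 0 <= f a) ->
  \esum_(a in [set: A]) f a =
  \sum_(a <- S) f a + \esum_(a in ~` [set` S]) f a.
Proof.
by move=> f0; rewrite (esumID [set` S])// !setTI esum_fset_nneg.
Qed.

(** A finite partial sum within [e] of the supremum leaves a tail of at most [e], the total being
    finite. *)
Lemma esum_tail (f : A -> \bar R) (e : R) : (forall a, 0 <= f a) ->
  \esum_(a in [set: A]) f a < +oo -> (0 < e)%R ->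
  exists S, \esum_(a in ~` [set` S]) f a <= e%:E.
Proof.
move=> f0 foo e0.
have ffin : \esum_(a in [set: A]) f a \is a fin_num.
  by rewrite ge0_fin_numE// esum_ge0.
have [_ [X [finX _] <-]] := ub_ereal_sup_adherent e0 ffin.
rewrite fsbig_finite//= => h; exists (fset_set X).
move: h; rewrite -/(\esum_(a in [set: A]) f a) (esum_fsetID (fset_set X))// => h.
have sfin : \sum_(a <- fset_set X) f a \is a fin_num.
  rewrite ge0_fin_numE ?sume_ge0//; apply: le_lt_trans foo.
  by rewrite (esum_fsetID (fset_set X))// leeDl// esum_ge0.
rewrite leNgt; apply/negP => he.
move: h; rewrite ltNge => /negP; apply.
by rewrite EFinN leeBrDr// leeD2l// ltW.
Qed.

(** If the right-hand side is infinite there is nothing to prove. Otherwise the positive and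
    negative tails are both finite, so [fine] loses nothing and the terms over [S] cancel. The value
    of [usum] on families that are not absolutely summable is thus harmless. *)
Lemma usum_dist_le (f : A -> R) S :
  `|usum f - \sum_(a <- S) f a|%:E <= \esum_(a in ~` [set` S]) `|f a|%:E.
Proof.
have [->|toofin] := eqVneq (\esum_(a in ~` [set` S]) `|f a|%:E) +oo.
  by rewrite leey.
have tfin : \esum_(a in ~` [set` S]) `|f a|%:E < +oo by rewrite ltey.
have pe0 a : 0 <= (EFin \o f)^\+ a by exact: funepos_ge0.
have ne0 a : 0 <= (EFin \o f)^\- a by exact: funeneg_ge0.
have absE a : `|f a|%:E = (EFin \o f)^\+ a + (EFin \o f)^\- a.
  by rewrite -/(abse _) -[LHS]/((abse \o (EFin \o f)) a) fune_abse.
have sE : \esum_(a in ~` [set` S]) `|f a|%:E =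
    \esum_(a in ~` [set` S]) (EFin \o f)^\+ a +
    \esum_(a in ~` [set` S]) (EFin \o f)^\- a.
  by rewrite -esumD//; apply: eq_esum => a _; exact: absE.
have pT : \esum_(a in ~` [set` S]) (EFin \o f)^\+ a \is a fin_num.
  rewrite ge0_fin_numE ?esum_ge0//; apply: le_lt_trans tfin.
  by rewrite sE leeDl// esum_ge0.
have nT : \esum_(a in ~` [set` S]) (EFin \o f)^\- a \is a fin_num.
  rewrite ge0_fin_numE ?esum_ge0//; apply: le_lt_trans tfin.
  by rewrite sE leeDr// esum_ge0.
rewrite /usum (esum_fsetID S pe0) (esum_fsetID S ne0) sE.
rewrite -(fineK pT) -(fineK nT).
set p := fine (\esum_(a in _) (EFin \o f)^\+ a).
set n := fine (\esum_(a in _) (EFin \o f)^\- a).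
have p0 : (0 <= p)%R by apply: fine_ge0; apply: esum_ge0 => a _.
have n0 : (0 <= n)%R by apply: fine_ge0; apply: esum_ge0 => a _.
have -> : \sum_(a <- S) (EFin \o f)^\+ a = (\sum_(a <- S) Num.max (f a) 0)%:E.
  by rewrite -sumEFin; apply: eq_bigr => a _; rewrite funeposE/= EFin_max.
have -> : \sum_(a <- S) (EFin \o f)^\- a = (\sum_(a <- S) Num.max (- f a) 0)%:E.
  by rewrite -sumEFin; apply: eq_bigr => a _; rewrite funenegE/= EFin_max.
rewrite -!EFinD /= lee_fin.
have -> : (\sum_(a <- S) f a =
    \sum_(a <- S) Num.max (f a) 0 - \sum_(a <- S) Num.max (- f a) 0)%R.
  rewrite -sumrB; apply: eq_bigr => a _; rewrite !maxEle.
  by case: leP => ?; case: leP => ?; lra.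
set s := (\sum_(a <- S) _)%R; set t := (\sum_(a <- S) _)%R.
rewrite (_ : (_ - _ = p - n)%R); last by ring.
by rewrite ler_norml; apply/andP; split; lra.
Qed.

Lemma emeasurable_esum d (T : measurableType d) D (h : A -> T -> \bar R) :
  (forall a, measurable_fun [set: T] (h a)) -> (forall a x, 0 <= h a x) ->
  measurable_fun [set: T] (fun x => \esum_(a in D) h a x).
Proof.
move=> mh h0; under eq_fun do rewrite esum_nneseries//.
apply: ge0_emeasurable_sum => [n x _ _|n _].
  by case: (pickle_inv n) => //= a; case: ifP.
case: (pickle_inv n) => [a|]/=; last exact: measurable_cst.
by case: (a \in D) => //; exact: measurable_cst.
Qed.

Lemma integral_esum d (T : measurableType d) (mu : {measure set T -> \bar R})
    D (h : A -> T -> \bar R) :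
  (forall a, measurable_fun [set: T] (h a)) -> (forall a x, 0 <= h a x) ->
  \int[mu]_x (\esum_(a in D) h a x) = \esum_(a in D) \int[mu]_x h a x.
Proof.
move=> mh h0; under eq_integral do rewrite esum_nneseries//.
rewrite integral_nneseries//; last 2 first.
  move=> n; case: (pickle_inv n) => [a|]/=; last exact: measurable_cst.
  by case: (a \in D) => //; exact: measurable_cst.
  by move=> n x _; case: (pickle_inv n) => //= a; case: ifP.
rewrite esum_nneseries; last by move=> a; apply: integral_ge0.
apply: eq_eseriesr => n _; case: (pickle_inv n) => //= [a|]; last first.
  by rewrite integral0.
by case: (a \in D) => //; rewrite integral0.
Qed.

Lemma measurable_usum d (T : measurableType d) (h : A -> T -> R) :
  (forall a, measurable_fun [set: T] (h a)) ->
  measurable_fun [set: T] (fun x => usum (fun a => h a x)).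
Proof.
move=> mh.
have mE a : measurable_fun [set: T] (EFin \o h a) by exact/measurable_EFinP.
have pos : measurable_fun [set: T]
    (fun x => \esum_(a in [set: A]) (EFin \o h a)^\+ x).
  by apply: emeasurable_esum => a; [exact: measurable_funepos|move=> x].
have neg : measurable_fun [set: T]
    (fun x => \esum_(a in [set: A]) (EFin \o h a)^\- x).
  by apply: emeasurable_esum => a; [exact: measurable_funeneg|move=> x].
rewrite (_ : (fun x => usum _) = fine \o (fun x =>
    \esum_(a in [set: A]) (EFin \o h a)^\+ x -
    \esum_(a in [set: A]) (EFin \o h a)^\- x)).
  apply: measurableT_comp; first exact: fine_measurable.
  exact: emeasurable_funB.
apply/funext => x; rewrite /usum/=; congr (fine (_ - _)); apply: eq_esum => a _.
  by rewrite !funeposE.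
by rewrite !funenegE.
Qed.

End countable_sums.

(** * Resampling a coordinate of a product measure *)

Section product_space.
Context {R : realType} {A : countType} {d : A -> measure_display}.
Context {E : forall a, measurableType (d a)}.
Variable P : forall a, probability (E a) R.
Variable PA : probability (prod_space E) R.
Hypothesis HPA : is_product_measure P PA.
Local Notation T := (prod_space E).

(** Resampling as a single map on [T * E a]: its law under the product measure is what has to be
    identified, and Tonelli's theorem applies to compositions with it. *)
Definition update (a : A) (z : T * E a) : T := dfwith z.1 a z.2.

Lemma measurable_coord (a : A) (B : set (E a)) : measurable B ->
  measurable ([set x | B (x a)] : set T).
Proof. by move=> mB; apply: sub_sigma_algebra; exists a, B. Qed.

Lemma measurable_update (a : A) : measurable_fun [set: T * E a] (@update a).
Proof.
apply: (@measurability _ _ _ T setT (@update a) (coord_sets E)) => //.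
move=> _ [_ [b [B mB ->]] <-]; rewrite setTI.
have [ab|ab] := eqVneq a b.
  case: _ / ab B mB => B mB.
  rewrite (_ : _ @^-1` _ = setT `*` B); first exact: measurableX.
  by apply/seteqP; split => [z|z [_]]; rewrite /update/= dfwithin.
rewrite (_ : _ @^-1` _ = [set x : T | B (x b)] `*` setT).
  by apply: measurableX => //; exact: measurable_coord.
by apply/seteqP; split => [z|z []]; rewrite /update/= dfwithout.
Qed.

Definition rectangle (J : {fset A}) (B : forall a, set (E a)) : set T :=
  [set x | forall a, a \in J -> B a (x a)].

Lemma measurable_rectangle J B : (forall a, measurable (B a)) ->
  measurable (rectangle J B).
Proof.
move=> mB; rewrite (_ : rectangle J B = \bigcap_(a in [set` J]) [set x : T | B a (x a)]).
  by apply: fin_bigcap_measurable => // a _; exact: measurable_coord.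
by apply/seteqP; split => x h a; exact: (h a).
Qed.

(** Padding with full factors brings two rectangles to a common index set, and allows the resampled
    coordinate to be assumed among the constrained ones. *)
Lemma rectangle_widen (J K : {fset A}) B : {subset J <= K} ->
  rectangle J B = rectangle K (fun a => if a \in J then B a else setT).
Proof.
move=> JK; apply/seteqP; split => x h a aK; first by case: ifP => // /h.
by have := h a (JK a aK); rewrite aK.
Qed.

(** The preimage is the rectangle with the constraint at [a] removed, times [B a]; independence puts
    the missing factor back. *)
Lemma product_measure_update_rectangle (a : A) J B : (forall a, measurable (B a)) ->
  (PA \x P a)%E (@update a @^-1` rectangle J B) = PA (rectangle J B).
Proof.
move=> mB; wlog aJ : J B mB / a \in J => [wl|].
  rewrite (@rectangle_widen J (a |` J)%fset).
    apply: wl; last by rewrite !inE eqxx.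
    by move=> b; case: ifP.
  by move=> b bJ; rewrite !inE bJ orbT.
have -> : @update a @^-1` rectangle J B = rectangle (J `\ a)%fset B `*` B a.
  apply/seteqP; split=> [[x y] h|[x y] [/= h1 h2] b bJ].
    split=> [b|]; last by have := h a aJ; rewrite /update/= dfwithin.
    rewrite !inE => /andP[ba bJ]; have := h b bJ.
    by rewrite /update/= dfwithout// eq_sym.
  rewrite /update/=; have [ab|ab] := eqVneq a b.
    by case: _ / ab bJ => _; rewrite dfwithin.
  by rewrite dfwithout//; apply: h1; rewrite !inE eq_sym ab.
rewrite product_measure1E//; last exact: measurable_rectangle.
rewrite [X in (X * _)%E](HPA (J `\ a)%fset mB) [RHS](HPA J mB).
rewrite (big_fsetD1 a aJ)/= mulrC EFinM fineK//.
exact: fin_num_measure.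
Qed.

(** Two finite measures that agree on rectangles, a pi-system generating the sigma-field, are
    equal. *)
Lemma product_measure_update (a : A) (C : set T) : measurable C ->
  (PA \x P a)%E (@update a @^-1` C) = PA C.
Proof.
move=> mC.
pose upd_mfun := isMeasurableFun.Build _ _ _ _ _ (@measurable_update a).
pose upd : {mfun (T * E a)%type >-> T} := HB.pack (@update a) upd_mfun.
pose G := [set C | exists (J : {fset A}) (B : forall a, set (E a)),
  (forall a, measurable (B a)) /\ C = rectangle J B].
have mG : G `<=` measurable.
  by move=> _ [J [B [mB ->]]]; exact: measurable_rectangle.
apply: (@g_sigma_algebra_measure_unique _ _ _ G mG (fun=> setT) _ _
  (pushforward (PA \x P a)%E upd) PA).
- move=> _; exists fset0, (fun=> setT); split => //.
  by apply/seteqP; split.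
- by rewrite bigcup_const//; exists 0%N.
- move=> _ _ [J [B [mB ->]]] [K [C' [mC' ->]]].
  exists (J `|` K)%fset, (fun a => (if a \in J then B a else setT) `&`
    (if a \in K then C' a else setT)); split.
    by move=> b; apply: measurableI; case: ifP.
  rewrite (@rectangle_widen J (J `|` K)%fset B); last first.
    by move=> b bJ; rewrite !inE bJ.
  rewrite (@rectangle_widen K (J `|` K)%fset C'); last first.
    by move=> b bK; rewrite !inE bK orbT.
  apply/seteqP; split => x.
    by move=> [h1 h2] b bJK; split; [exact: h1|exact: h2].
  by move=> h; split => b /h [].
- by move=> _ [J [B [mB ->]]]; exact: product_measure_update_rectangle.
- move=> _ /=; rewrite /pushforward/= preimage_setT -setXTT product_measure1E//.
  by rewrite ltey_eq fin_numM ?fin_num_measure.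
have := mC; apply: smallest_sub; first exact: smallest_sigma_algebra.
move=> _ [b [B mB ->]]; apply: sub_sigma_algebra.
exists [fset b]%fset, (dfwith (fun c : A => setT : set (E c)) b B); split.
  by move=> c; case: dfwithP.
apply/seteqP; split => x /= h.
  by move=> c; rewrite inE => /eqP ->; rewrite dfwithin.
by have := h b; rewrite !inE eqxx dfwithin; exact.
Qed.

Lemma measurable_fun_update d' (S : measurableType d') (a : A) (h : T -> S) :
  measurable_fun setT h -> measurable_fun [set: T * E a] (h \o @update a).
Proof. by move=> mh; apply: measurableT_comp => //; exact: measurable_update. Qed.

Lemma measurable_fun_dfwith d' (S : measurableType d') (a : A) (h : T -> S) (x : T) :
  measurable_fun setT h -> measurable_fun [set: E a] (fun y => h (dfwith x a y)).
Proof.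
move=> /(@measurable_fun_update _ _ a) mh.
exact: (measurableT_comp mh (measurable_pair1 x)).
Qed.

Lemma ge0_integral_update (a : A) (h : T -> \bar R) :
  measurable_fun setT h -> (forall x, 0 <= h x)%E ->
  (\int[PA]_x \int[P a]_y h (dfwith x a y) = \int[PA]_x h x)%E.
Proof.
move=> mh h0.
have mhu := measurable_fun_update (a:=a) mh.
transitivity (\int[(PA \x P a)]_z (h \o @update a) z)%E.
  by rewrite fubini_tonelli1//= => z; exact: h0.
pose upd_mfun := isMeasurableFun.Build _ _ _ _ _ (@measurable_update a).
pose upd : {mfun (T * E a)%type >-> T} := HB.pack (@update a) upd_mfun.
transitivity (\int[pushforward (PA \x P a)%E upd]_x h x)%E.
  by rewrite ge0_integral_pushforward.
apply: eq_measure_integral => C mC _.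
exact: product_measure_update.
Qed.

Lemma measurable_integral_update (a : A) (h : T -> \bar R) :
  measurable_fun setT h -> (forall x, 0 <= h x)%E ->
  measurable_fun [set: T] (fun x => \int[P a]_y h (dfwith x a y))%E.
Proof.
move=> mh h0.
have := @measurable_fun_fubini_tonelli_F _ _ _ _ _ (P a) (h \o @update a)
  (measurable_fun_update (a:=a) mh) (fun z => h0 _).
exact.
Qed.

Lemma dfwith_dfwith (x : T) (a : A) (y y' : E a) :
  dfwith (dfwith x a y) a y' = dfwith x a y' :> T.
Proof.
apply: functional_extensionality_dep => b; case: (dfwithP (dfwith x a y) y' b).
  by rewrite dfwithin.
by move=> c ac; rewrite !dfwithout.
Qed.

End product_space.

(** * Square norms and the gradient *)

Section square_norm.
Context {R : realType} {d} {T : measurableType d} (Q : probability T R).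
Implicit Types u v w : T -> R.

(** The squared L^2 norm, kept in the extended reals so that inequalities need no finiteness
    hypothesis. Working with squares replaces the triangle inequality by (a + b)^2 <= 2 a^2 + 2
    b^2. *)
Definition sqnorm u : \bar R := (\int[Q]_x (u x ^+ 2)%:E)%E.

Lemma sqnorm_ge0 u : (0 <= sqnorm u)%E.
Proof. by apply: integral_ge0 => x _; rewrite lee_fin sqr_ge0. Qed.

Lemma measurable_EFin_sqr u : measurable_fun setT u ->
  measurable_fun setT (fun x => (u x ^+ 2)%:E).
Proof. by move=> mu; apply/measurable_EFinP; exact: measurable_funX. Qed.

Lemma integral_cst_probability (k : \bar R) : (\int[Q]_x cst k x = k)%E.
Proof.
by rewrite (integral_cst Q measurableT) [X in (_ * X)%E](probability_setT Q) mule1.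
Qed.

Lemma sqnorm_cst (k : R) : sqnorm (cst k) = (k ^+ 2)%:E.
Proof.
by rewrite -[RHS]integral_cst_probability.
Qed.

Lemma sqnorm_le_ae u v w : measurable_fun setT u -> measurable_fun setT v ->
  measurable_fun setT w ->
  {ae Q, forall x, w x ^+ 2 <= 2 * (u x ^+ 2) + 2 * (v x ^+ 2)} ->
  (sqnorm w <= 2%:E * sqnorm u + 2%:E * sqnorm v)%E.
Proof.
move=> mu mv mw wuv; have mu2 := measurable_EFin_sqr mu.
have mv2 := measurable_EFin_sqr mv.
have m2 (h : T -> \bar R) : measurable_fun setT h ->
    measurable_fun setT (fun x => 2%:E * h x)%E.
  by move=> mh; exact: measurable_funeM.
rewrite -!ge0_integralZl_EFin//; [|by move=> x _; rewrite lee_fin sqr_ge0..].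
rewrite -ge0_integralD//; last 4 first.
- by move=> x _; rewrite mule_ge0// lee_fin sqr_ge0.
- exact: m2.
- by move=> x _; rewrite mule_ge0// lee_fin sqr_ge0.
- exact: m2.
apply: ae_ge0_le_integral => //.
- by move=> x _; rewrite lee_fin sqr_ge0.
- exact: measurable_EFin_sqr.
- by move=> x _; rewrite adde_ge0// mule_ge0// lee_fin sqr_ge0.
- by apply: emeasurable_funD; exact: m2.
- by apply: filterS wuv => x h _; rewrite -!EFinM -EFinD lee_fin.
Qed.

(** A weighted form of 2ab <= a^2 + b^2, in the role of Cauchy-Schwarz. The weight [l] lets a small
    first factor compensate a second one that is only bounded. *)
Lemma integral_norm_mul_le u v (l : R) : measurable_fun setT u ->
  measurable_fun setT v -> 0 < l ->
  (\int[Q]_x `|u x * v x|%:E <= l%:E * sqnorm u + l^-1%:E * sqnorm v)%E.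
Proof.
move=> mu mv l0; have mu2 := measurable_EFin_sqr mu.
have mv2 := measurable_EFin_sqr mv.
have l0' : 0 <= l := ltW l0; have li0 : 0 <= l^-1 by rewrite invr_ge0.
have mk (k : R) (h : T -> \bar R) : measurable_fun setT h ->
    measurable_fun setT (fun x => k%:E * h x)%E.
  by move=> mh; exact: measurable_funeM.
rewrite -!ge0_integralZl_EFin//; [|by move=> x _; rewrite lee_fin sqr_ge0..].
rewrite -ge0_integralD//; last 4 first.
- by move=> x _; rewrite mule_ge0// lee_fin// sqr_ge0.
- exact: mk.
- by move=> x _; rewrite mule_ge0// lee_fin// sqr_ge0.
- exact: mk.
apply: ge0_le_integral => //.
- apply/measurable_EFinP; apply: measurableT_comp => //.
  exact: measurable_funM.
- by apply: emeasurable_funD; exact: mk.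
move=> x _; rewrite -!EFinM -EFinD lee_fin normrM.
rewrite -[u x ^+ 2]real_normK ?num_real// -[v x ^+ 2]real_normK ?num_real//.
have := normr_ge0 (u x); have := normr_ge0 (v x).
move: `|u x| `|v x| => a b b0 a0.
have : 0 <= l^-1 * (l * a - b) ^+ 2 by rewrite mulr_ge0// sqr_ge0.
have -> : l^-1 * (l * a - b) ^+ 2 = l * a ^+ 2 - 2 * (a * b) + l^-1 * b ^+ 2.
  by field; rewrite gt_eqF.
have : 0 <= a * b by rewrite mulr_ge0.
lra.
Qed.

Lemma integrable_mul_sqnorm u v : measurable_fun setT u ->
  measurable_fun setT v -> (sqnorm u < +oo)%E -> (sqnorm v < +oo)%E ->
  Q.-integrable setT (EFin \o (fun x => u x * v x)).
Proof.
move=> mu mv u2 v2; apply/integrableP; split.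
  by apply/measurable_EFinP; exact: measurable_funM.
apply: (le_lt_trans (integral_norm_mul_le mu mv (@ltr01 R))).
by rewrite invr1 !mul1e lte_add_pinfty.
Qed.

Lemma integrable_sqnorm u : measurable_fun setT u -> (sqnorm u < +oo)%E ->
  Q.-integrable setT (EFin \o u).
Proof.
move=> mu u2; rewrite (_ : u = fun x => u x * cst 1 x); last first.
  by apply/funext => x; rewrite mulr1.
by apply: integrable_mul_sqnorm => //; rewrite sqnorm_cst ltry.
Qed.

Lemma integrable_sqr_sqnorm u : measurable_fun setT u -> (sqnorm u < +oo)%E ->
  Q.-integrable setT (fun x => (u x ^+ 2)%:E).
Proof.
move=> mu u2; apply/integrableP; split; first exact: measurable_EFin_sqr.
by under eq_integral do rewrite gee0_abs ?lee_fin ?sqr_ge0//.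
Qed.

Lemma integrable_lip_comp (f : R -> R) u : measurable_fun setT f ->
  (forall s t, `|f s - f t| <= `|s - t|) -> measurable_fun setT u ->
  Q.-integrable setT (EFin \o u) -> Q.-integrable setT (EFin \o (f \o u)).
Proof.
move=> mf lf mu iu.
have ic : Q.-integrable setT (EFin \o (fun x => `|f 0| + `|u x|)).
  have -> : EFin \o (fun x => `|f 0| + `|u x|) =
      (cst `|f 0|%:E \+ abse \o (EFin \o u))%E by apply/funext.
  apply: integrableD => //; last exact: integrable_abse.
  exact: finite_measure_integrable_cst.
apply: le_integrable ic => //.
  by apply/measurable_EFinP; exact: measurableT_comp.
move=> x _ /=; rewrite lee_fin [leRHS]ger0_norm ?addr_ge0//.
have := lf (u x) 0; rewrite subr0 => h.
by rewrite -(subrK (f 0) (f (u x))) (le_trans (ler_normD _ _))// addrC lerD2l.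
Qed.

Lemma sqnorm_lip_comp (f : R -> R) u : measurable_fun setT f ->
  (forall s t, `|f s - f t| <= `|s - t|) -> measurable_fun setT u ->
  (sqnorm u < +oo)%E -> (sqnorm (f \o u) < +oo)%E.
Proof.
move=> mf lf mu u2.
have h : (sqnorm (f \o u) <= 2%:E * sqnorm (cst (f 0%R)) + 2%:E * sqnorm u)%E.
  apply: sqnorm_le_ae => //; first exact: measurableT_comp.
  apply: aeW => x /=.
  have := lf (u x) 0; rewrite subr0 -(@ler_pXn2r _ 2)// ?nnegrE//.
  rewrite !real_normK ?num_real//.
  (* The identity behind it is 2 b^2 + 2 (a - b)^2 - a^2 = (a - 2 b)^2. *)
  by have := sqr_ge0 (f (u x) - 2 * f 0); lra.
apply: (le_lt_trans h).
by rewrite lte_add_pinfty// lte_mul_pinfty// sqnorm_cst ltry.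
Qed.

Lemma normr_Rintegral_le u : Q.-integrable setT (EFin \o u) ->
  (`|\int[Q]_x u x|%:E <= \int[Q]_x `|u x|%:E)%E.
Proof.
move=> iu; apply: (@le_trans _ _ (\int[Q]_x `|u x|)%:E).
  by rewrite lee_fin; exact: le_normr_Rintegral.
by rewrite /Rintegral fineK//; exact: integrable_fin_num (integrable_abse iu).
Qed.

Lemma integrable_EFin_sum (I : Type) (s : seq I) (u : I -> T -> R) :
  (forall i, Q.-integrable setT (EFin \o u i)) ->
  Q.-integrable setT (EFin \o (fun x => \sum_(i <- s) u i x)).
Proof.
move=> iu; rewrite (_ : _ \o _ = fun x => (\sum_(i <- s) (EFin \o u i) x)%E).
  exact: integrable_sum.
by apply/funext => x; rewrite /= sumEFin.
Qed.

Lemma Rintegral_sum (I : Type) (s : seq I) (u : I -> T -> R) :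
  (forall i, Q.-integrable setT (EFin \o u i)) ->
  \int[Q]_x (\sum_(i <- s) u i x) = \sum_(i <- s) \int[Q]_x u i x.
Proof.
move=> iu; rewrite /Rintegral; under eq_integral do rewrite -sumEFin.
rewrite integral_sum//= sum_fine// => i _.
exact: integrable_fin_num (iu i).
Qed.

(** Jensen's inequality for the square: u^2 lies above its tangent 2 m u - m^2 at the mean [m],
    whose integral is m^2. *)
Lemma sqr_Rintegral_le u : measurable_fun setT u ->
  (((\int[Q]_x u x) ^+ 2)%:E <= sqnorm u)%E.
Proof.
move=> mu; have [->|] := eqVneq (sqnorm u) +oo%E; first by rewrite leey.
rewrite -ltey => u2; have iu := integrable_sqnorm mu u2.
have iu2 := integrable_sqr_sqnorm mu u2.
set m := Rintegral _ _ _.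
have im : Q.-integrable setT (fun x => (2 * m)%:E * (u x)%:E)%E.
  exact: integrableZl.
have ic : Q.-integrable setT (cst (m ^+ 2)%:E).
  by apply: finite_measure_integrable_cst.
have -> : (m ^+ 2)%:E =
    (\int[Q]_x ((2 * m)%:E * (u x)%:E - cst (m ^+ 2)%:E x))%E.
  rewrite integralB// integralZl// integral_cst_probability.
  rewrite (_ : (\int[Q]_x (u x)%:E)%E = m%:E).
    by rewrite -EFinM -EFinB; congr EFin; ring.
  by rewrite /m /Rintegral fineK//; exact: integrable_fin_num.
apply: le_integral => //; first exact: integrableB.
move=> x _; rewrite /= -EFinM -EFinB lee_fin.
by have := sqr_ge0 (u x - m); lra.
Qed.

Lemma Lfun2P u :
  u \in Lfun Q 2%:E <-> measurable_fun setT u /\ (sqnorm u < +oo)%E.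
Proof.
split=> [u2|[mu u2]].
  split; first by move: u2; rewrite inE => /andP[+ _]; rewrite inE.
  have /integrableP[_] := Lfun2_integrable_sqr u2.
  by under eq_integral do rewrite /= ger0_norm ?sqr_ge0//.
rewrite inE; apply/andP; split; rewrite inE//=.
rewrite /finite_norm unlock/= poweR_lty//.
under eq_integral do rewrite powR_mulrn// real_normK ?num_real//.
exact: u2.
Qed.

End square_norm.

Section gradient.
Context {R : realType} {A : countType} {d : A -> measure_display}.
Context {E : forall a, measurableType (d a)}.
Variable P : forall a, probability (E a) R.
Variable PA : probability (prod_space E) R.
Hypothesis HPA : is_product_measure P PA.
Local Notation T := (prod_space E).
Implicit Types (u v w : T -> R) (a : A).

Lemma measurable_grad u a : measurable_fun setT u ->
  measurable_fun setT (grad P u a).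
Proof.
move=> mu; apply: measurable_funB => //.
have muE : measurable_fun setT (EFin \o u) by exact/measurable_EFinP.
rewrite (_ : (fun x => _) = fine \o (fun x =>
    (\int[P a]_y ((EFin \o u)^\+ (dfwith x a y)) -
     \int[P a]_y ((EFin \o u)^\- (dfwith x a y))))%E).
  apply: measurableT_comp; first exact: fine_measurable.
  apply: emeasurable_funB; apply: measurable_integral_update => //.
    exact: measurable_funepos.
  exact: measurable_funeneg.
apply/funext => x; rewrite /Rintegral integralE/=.
by congr (fine (_ - _)); apply: eq_integral => y _; rewrite ?funeposE ?funenegE.
Qed.

(** Resampling invariance makes the square norms of the sections integrate to [sqnorm PA u], so
    almost all of them are finite. The integral inside [grad] is linear only at such points. *)
Lemma ae_integrable_dfwith u a : measurable_fun setT u -> (sqnorm PA u < +oo)%E ->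
  {ae PA, forall x, (P a).-integrable setT (EFin \o (fun y => u (dfwith x a y)))}.
Proof.
move=> mu u2; have mu2 := measurable_EFin_sqr mu.
have u20 x : (0 <= (u x ^+ 2)%:E)%E by rewrite lee_fin sqr_ge0.
have : PA.-integrable setT (fun x : T => \int[P a]_y (u (dfwith x a y) ^+ 2)%:E)%E.
  apply/integrableP; split.
    exact: (@measurable_integral_update _ _ _ _ P a (fun x => (u x ^+ 2)%:E)).
  under eq_integral.
    move=> x _; rewrite gee0_abs; last by apply: integral_ge0 => y _.
    over.
  by rewrite (ge0_integral_update HPA a mu2 u20).
move/integrable_ae => /(_ measurableT); apply: filterS => x /= /(_ I) h.
apply: integrable_sqnorm; first exact: measurable_fun_dfwith.
by rewrite -ge0_fin_numE ?sqnorm_ge0.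
Qed.

Lemma integral_sqnorm_dfwith u a : measurable_fun setT u ->
  (\int[PA]_x sqnorm (P a) (fun y => u (dfwith x a y)) = sqnorm PA u)%E.
Proof.
move=> mu.
by apply: (ge0_integral_update HPA a (measurable_EFin_sqr mu)) => x; rewrite lee_fin sqr_ge0.
Qed.

(* Both terms of the bound have the same integral, since resampling a coordinate
   preserves [PA]. *)
Lemma sqnorm_le_resample u w a : measurable_fun setT u -> measurable_fun setT w ->
  {ae PA, forall x, ((w x ^+ 2)%:E <= 2%:E * (u x ^+ 2)%:E +
     2%:E * sqnorm (P a) (fun y => u (dfwith x a y)))%E} ->
  (sqnorm PA w <= 4%:E * sqnorm PA u)%E.
Proof.
move=> mu mw wu; have mu2 := measurable_EFin_sqr mu.
have u20 x : (0 <= (u x ^+ 2)%:E)%E by rewrite lee_fin sqr_ge0.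
have mI : measurable_fun [set: T] (fun x : T => sqnorm (P a) (fun y => u (dfwith x a y))).
  exact: (@measurable_integral_update _ _ _ _ P a (fun x => (u x ^+ 2)%:E)).
have m2 (h : T -> \bar R) : measurable_fun setT h ->
    measurable_fun setT (fun x => 2%:E * h x)%E.
  by move=> mh; exact: measurable_funeM.
have -> : (4%:E * sqnorm PA u = 2%:E * sqnorm PA u + 2%:E * sqnorm PA u)%E.
  by rewrite -ge0_muleDl// -EFinD; congr (_%:E * _)%E; ring.
rewrite -{2}(integral_sqnorm_dfwith a mu).
rewrite -!ge0_integralZl_EFin//; last by move=> x _; exact: sqnorm_ge0.
rewrite -ge0_integralD//; last 4 first.
- by move=> x _; rewrite mule_ge0.
- exact: m2.
- by move=> x _; rewrite mule_ge0// sqnorm_ge0.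
- exact: m2.
apply: ae_ge0_le_integral => //.
- by move=> x _; rewrite lee_fin sqr_ge0.
- exact: measurable_EFin_sqr.
- by move=> x _; rewrite adde_ge0// mule_ge0// sqnorm_ge0.
- by apply: emeasurable_funD; exact: m2.
- by apply: filterS wu => x h _.
Qed.

Lemma sqnorm_grad_le u a : measurable_fun setT u ->
  (sqnorm PA (grad P u a) <= 4%:E * sqnorm PA u)%E.
Proof.
move=> mu; apply: (sqnorm_le_resample (a := a)) => //; first exact: measurable_grad.
apply: aeW => x.
have := sqr_Rintegral_le (P a) (measurable_fun_dfwith (a := a) x mu).
rewrite /grad; set m := Rintegral _ _ _ => mle.
apply: (@le_trans _ _ (2%:E * (u x ^+ 2)%:E + 2%:E * (m ^+ 2)%:E)%E).
  rewrite -!EFinM -EFinD lee_fin.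
  by have := sqr_ge0 (u x + m); lra.
by rewrite leeD2l// lee_pmul2l.
Qed.

(** D_a f(u) is the average of the differences f(u) - f(u'), where u' is resampled at [a]. Jensen
    and the Lipschitz condition bound its square by the average of (u - u')^2, which the gradient of
    [u] controls. *)
Lemma sqnorm_grad_lip (f : R -> R) u a : measurable_fun setT f ->
  (forall s t, `|f s - f t| <= `|s - t|) ->
  measurable_fun setT u -> (sqnorm PA u < +oo)%E ->
  (sqnorm PA (grad P (f \o u) a) <= 4%:E * sqnorm PA (grad P u a))%E.
Proof.
move=> mf lf mu u2; have mfu : measurable_fun setT (f \o u).
  exact: measurableT_comp.
apply: (sqnorm_le_resample (a := a)); [exact: measurable_grad..|].
have := ae_integrable_dfwith a mu u2.
apply: (@filterS _ _ (ae_filter_ringOfSetsType PA)) => x ix.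
have mux := measurable_fun_dfwith (a := a) x mu.
have mfux := measurable_fun_dfwith (a := a) x mfu.
pose v y := f (u x) - f (u (dfwith x a y)).
have mv : measurable_fun setT v by exact: measurable_funB.
have ifx : (P a).-integrable setT (EFin \o (fun y => f (u (dfwith x a y)))).
  exact: (integrable_lip_comp mf lf mux ix).
have -> : grad P (f \o u) a x = \int[P a]_y v y.
  rewrite RintegralB//; last exact: finite_measure_integrable_cst.
  rewrite Rintegral_cst// [X in fine X](probability_setT (P a)) mulr1.
  by [].
apply: le_trans (sqr_Rintegral_le (P a) mv) _.
set w := fun y => u x - u (dfwith x a y).
have vw : (sqnorm (P a) v <= sqnorm (P a) w)%E.
  apply: ge0_le_integral => //.
  - by move=> y _; rewrite lee_fin sqr_ge0.
  - exact: measurable_EFin_sqr.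
  - by apply: measurable_EFin_sqr; exact: measurable_funB.
  - move=> y _; rewrite lee_fin -[v y ^+ 2]real_normK ?num_real//.
    by rewrite -[w y ^+ 2]real_normK ?num_real// lerXn2r ?nnegrE//; exact: lf.
apply: (le_trans vw).
have -> : (2%:E * (grad P u a x ^+ 2)%:E =
    2%:E * sqnorm (P a) (cst (grad P u a x)))%E by rewrite sqnorm_cst.
apply: sqnorm_le_ae => //.
- by apply: measurable_fun_dfwith; exact: measurable_grad.
- exact: measurable_funB.
(* The average over coordinate [a] is unchanged by resampling it, so u - u' is also the difference
   of the two values of the gradient. *)
apply: aeW => y; rewrite /w /grad.
have -> : \int[P a]_y0 u (dfwith (dfwith x a y) a y0) = \int[P a]_y0 u (dfwith x a y0).
  by apply: eq_Rintegral => y0 _; rewrite dfwith_dfwith.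
set m := Rintegral _ _ _.
by have := sqr_ge0 ((u x - m) + (u (dfwith x a y) - m)); rewrite /=; lra.
Qed.

Lemma gradB_ae u v a : measurable_fun setT u -> measurable_fun setT v ->
  (sqnorm PA u < +oo)%E -> (sqnorm PA v < +oo)%E ->
  {ae PA, forall x, grad P (fun t => u t - v t) a x = grad P u a x - grad P v a x}.
Proof.
move=> mu mv u2 v2.
have := ae_integrable_dfwith a mv v2; have := ae_integrable_dfwith a mu u2.
apply: (@filterS2 _ _ (ae_filter_ringOfSetsType PA)).
by move=> x iu iv; rewrite /grad RintegralB//; ring.
Qed.

End gradient.

Section esum_scaling.
Context {R : realType} {A : countType}.
Local Open Scope ereal_scope.

Lemma ge0_esumZl (D : set A) (k : R) (f : A -> \bar R) : (0 <= k)%R ->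
  (forall a, 0 <= f a) ->
  \esum_(a in D) (k%:E * f a) = k%:E * \esum_(a in D) f a.
Proof.
move=> k0 f0; rewrite !esum_nneseries//; last by move=> a; rewrite mule_ge0.
rewrite -nneseriesZl//; last first.
  by move=> n _; case: (pickle_inv n) => //= a; case: ifP.
apply: eq_eseriesr => n _; case: (pickle_inv n) => [a|]/=; last by rewrite mule0.
by case: ifP; rewrite ?mule0.
Qed.

End esum_scaling.

(** * Smallness of products with one small factor *)

Section small_products.
Context {R : realType} {A : countType}.
Context {d} {T : measurableType d} (Q : probability T R).

(** The choice of [l] makes [k / l] at most [e / 2], the [+ 1] keeping it positive for [k = 0]; then
    [de] makes [l * de] equal to [e / 2]. *)
Let weight (k e : R) : 0 <= k -> 0 < e ->
  exists l de : R, [/\ 0 < l, 0 < de & l * de + l^-1 * k <= e].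
Proof.
move=> k0 e0; pose l := (2 * k + 1) / e.
have l0 : 0 < l by rewrite divr_gt0// ltr_wpDl// mulr_ge0.
exists l, (e / 2 / l); split => //; first by rewrite divr_gt0// divr_gt0.
rewrite mulrC divfK ?gt_eqF// /l invf_div mulrAC.
have h : 0 < 2 * k + 1 by rewrite ltr_wpDl// mulr_ge0.
have : e * k / (2 * k + 1) <= e / 2.
  by rewrite ler_pdivrMr//; lra.
lra.
Qed.

Lemma integral_norm_mul_small (k e : R) : 0 <= k -> 0 < e ->
  exists2 de : R, 0 < de & forall u v : T -> R,
    measurable_fun setT u -> measurable_fun setT v ->
    (sqnorm Q u <= de%:E)%E -> (sqnorm Q v <= k%:E)%E ->
    (\int[Q]_x `|u x * v x|%:E <= e%:E)%E.
Proof.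
move=> k0 e0; have [l [de [l0 de0 h]]] := weight k0 e0.
exists de => // u v mu mv ude vk.
apply: (le_trans (integral_norm_mul_le Q mu mv l0)).
apply: (@le_trans _ _ (l%:E * de%:E + l^-1%:E * k%:E)%E).
  by apply: leeD; apply: lee_wpmul2l => //; rewrite lee_fin ?invr_ge0 ltW.
by rewrite -!EFinM -EFinD lee_fin.
Qed.

(** The threshold depends on [k] and [e] only. It can therefore be fixed before the index set and
    the approximating variable are chosen. *)
Lemma esum_integral_norm_mul_small (k e : R) : 0 <= k -> 0 < e ->
  exists2 de : R, 0 < de & forall (D : set A) (u v : A -> T -> R),
    (forall a, measurable_fun setT (u a)) ->
    (forall a, measurable_fun setT (v a)) ->
    (\esum_(a in D) sqnorm Q (u a) <= de%:E)%E ->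
    (\esum_(a in D) sqnorm Q (v a) <= k%:E)%E ->
    (\esum_(a in D) \int[Q]_x `|u a x * v a x|%:E <= e%:E)%E.
Proof.
move=> k0 e0; have [l [de [l0 de0 h]]] := weight k0 e0.
have l0' := ltW l0; have li0 : 0 <= l^-1 by rewrite invr_ge0.
exists de => // D u v mu mv ude vk.
apply: (@le_trans _ _ (\esum_(a in D)
    (l%:E * sqnorm Q (u a) + l^-1%:E * sqnorm Q (v a))))%E.
  by apply: le_esum => a _; exact: integral_norm_mul_le.
rewrite esumD; last 2 first.
- by move=> a _; rewrite mule_ge0 ?lee_fin// sqnorm_ge0.
- by move=> a _; rewrite mule_ge0 ?lee_fin// sqnorm_ge0.
rewrite !ge0_esumZl//; [|by move=> a; exact: sqnorm_ge0..].
apply: (@le_trans _ _ (l%:E * de%:E + l^-1%:E * k%:E)%E).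
  by apply: leeD; apply: lee_wpmul2l.
by rewrite -!EFinM -EFinD lee_fin.
Qed.

Lemma Rintegral_dist_le (u v : T -> R) (e : R) :
  Q.-integrable setT (EFin \o u) -> Q.-integrable setT (EFin \o v) ->
  (\int[Q]_x `|u x - v x|%:E <= e%:E)%E ->
  `|\int[Q]_x u x - \int[Q]_x v x| <= e.
Proof.
move=> iu iv uv; rewrite -RintegralB// -lee_fin; apply: le_trans uv.
by apply: normr_Rintegral_le; exact: (integrableB measurableT iu iv).
Qed.

End small_products.

(** * Cylindrical approximation in the domain of the gradient *)

Section domain_of_gradient.
Context {R : realType} {A : countType} {d : A -> measure_display}.
Context {E : forall a, measurableType (d a)}.
Variable P : forall a, probability (E a) R.
Variable PA : probability (prod_space E) R.
Hypothesis HPA : is_product_measure P PA.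
Local Notation T := (prod_space E).
Implicit Types (u v w C : T -> R) (a : A).

Lemma D_norm_lt u (e : R) : (D_norm P PA u < e%:E)%E ->
  (sqnorm PA u <= (e ^+ 2)%:E)%E /\
  (\esum_(a in [set: A]) sqnorm PA (grad P u a) <= (e ^+ 2)%:E)%E.
Proof.
rewrite /D_norm unlock.
have -> : (\esum_(a in [set: A]) \int[PA]_x (`|grad P u a x| ^+ 2)%:E =
    \esum_(a in [set: A]) sqnorm PA (grad P u a))%E.
  apply: eq_esum => a _; apply: eq_integral => x _.
  by rewrite real_normK ?num_real.
rewrite -/(sqnorm PA u).
set s := esum _ _; have s0 : (0 <= s)%E by apply: esum_ge0 => a _; exact: sqnorm_ge0.
have u0 := sqnorm_ge0 PA u.
move=> h; have e0 : 0 < e by rewrite -lte_fin (le_lt_trans _ h)// poweR_ge0.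
have us : (sqnorm PA u + s <= (e ^+ 2)%:E)%E.
  rewrite leNgt; apply/negP => eus.
  move: h; rewrite ltNge => /negP; apply.
  have -> : e%:E = ((e ^+ 2)%:E `^ 2^-1)%E.
    by rewrite poweR_EFin -powR_mulrn ?(ltW e0)// -powRrM mulfV// powRr1// ltW.
  apply: gt0_ler_poweR; rewrite ?in_itv/= ?leey ?andbT//.
  - by rewrite lee_fin sqr_ge0.
  - exact: adde_ge0 u0 s0.
  - exact: (ltW eus).
by split; apply: le_trans us; [exact: leeDl|exact: leeDr].
Qed.

Lemma measurable_in_D u : in_D P PA u ->
  measurable_fun setT u /\ (sqnorm PA u < +oo)%E.
Proof. by move=> [/Lfun2P]. Qed.

Lemma measurable_cylindrical C : cylindrical PA C ->
  measurable_fun setT C /\ (sqnorm PA C < +oo)%E.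
Proof. by move=> [/Lfun2P]. Qed.

Lemma cylindrical_in_D C : cylindrical PA C -> in_D P PA C.
Proof.
move=> cC; split=> [|e e0]; first by case: cC.
exists C => //; rewrite /D_norm unlock.
have z x : (C x - C x) ^+ 2 = 0 :> R by rewrite subrr expr0n.
under eq_integral do rewrite z.
rewrite integral0 add0e esum1.
  by rewrite poweR_EFin powR0 ?lte_fin// invr_neq0.
move=> a _; rewrite (eq_integral (cst 0%E)) ?integral0// => x _ /=.
rewrite /grad (@eq_Rintegral _ _ _ (P a) setT (cst 0)); last first.
  by move=> y _; rewrite subrr.
by rewrite Rintegral_cst// mul0r !subrr normr0 expr0n.
Qed.

Lemma cylindrical_lip (f : R -> R) C : measurable_fun setT f ->
  (forall s t, `|f s - f t| <= `|s - t|) ->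
  cylindrical PA C -> cylindrical PA (f \o C).
Proof.
move=> mf lf cC; have [mC C2] := measurable_cylindrical cC.
have mfC : measurable_fun setT (f \o C) by exact: measurableT_comp.
split; last first.
  by case: cC => _ [J CJ]; exists J => x y xy /=; rewrite (CJ _ _ xy).
by apply/Lfun2P; split => //; exact: sqnorm_lip_comp.
Qed.

(** Only the finitely many coordinates in [J] contribute: resampling another one leaves [C]
    unchanged. *)
Lemma esum_grad_cylindrical C : cylindrical PA C ->
  (\esum_(a in [set: A]) sqnorm PA (grad P C a) < +oo)%E.
Proof.
move=> cC; have [mC C2] := measurable_cylindrical cC.
have [_ [J CJ]] := cC.
rewrite (esum_fsetID J); last by move=> a; exact: sqnorm_ge0.
rewrite [X in (_ + X)%E]esum1 ?adde0; last first.
  move=> a aJ; rewrite /sqnorm (eq_integral (cst 0%E)) ?integral0// => x _ /=.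
  rewrite /grad (@eq_Rintegral _ _ _ (P a) setT (cst (C x))); last first.
    move=> y _ /=; apply: CJ => b bJ; rewrite dfwithout//.
    by apply: contra_not_neq aJ => ->.
  by rewrite Rintegral_cst// [X in fine X](probability_setT (P a)) mulr1 subrr expr0n.
apply: lte_sum_pinfty => a _.
apply: (le_lt_trans (sqnorm_grad_le HPA a mC)).
by rewrite lte_mul_pinfty.
Qed.

Lemma esum_sqnorm_le_ae (u v w : A -> T -> R) :
  (forall a, measurable_fun setT (u a)) -> (forall a, measurable_fun setT (v a)) ->
  (forall a, measurable_fun setT (w a)) ->
  (forall a, {ae PA, forall x, w a x ^+ 2 <= 2 * (u a x ^+ 2) + 2 * (v a x ^+ 2)}) ->
  (\esum_(a in [set: A]) sqnorm PA (w a) <=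
   2%:E * (\esum_(a in [set: A]) sqnorm PA (u a)) +
   2%:E * (\esum_(a in [set: A]) sqnorm PA (v a)))%E.
Proof.
move=> mu mv mw wuv; rewrite -!ge0_esumZl//; [|by move=> a; exact: sqnorm_ge0..].
rewrite -esumD; last 2 first.
- by move=> a _; rewrite mule_ge0// sqnorm_ge0.
- by move=> a _; rewrite mule_ge0// sqnorm_ge0.
by apply: le_esum => a _; exact: sqnorm_le_ae.
Qed.

(** The point is that [M] does not depend on [e]. Since D_aC = D_au - D_a(u - C), twice the squared
    gradient norm of [u] plus 2 is enough once [C] is within 1 of [u]. *)
Lemma in_D_approx u : in_D P PA u -> exists M : R, [/\ 0 <= M,
  (\esum_(a in [set: A]) sqnorm PA (grad P u a) <= M%:E)%E &
  forall e : R, 0 < e -> exists C, [/\ cylindrical PA C,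
    (sqnorm PA (fun x => u x - C x)%R <= e%:E)%E &
    (\esum_(a in [set: A]) sqnorm PA (grad P C a) <= M%:E)%E]].
Proof.
move=> uD; have [mu u2] := measurable_in_D uD.
have [_ approx] := uD.
have dist C : cylindrical PA C -> measurable_fun setT (fun x => u x - C x)%R.
  by move=> /measurable_cylindrical[mC _]; exact: measurable_funB.
pose s := (\esum_(a in [set: A]) sqnorm PA (grad P u a))%E.
have s0 : (0 <= s)%E by apply: esum_ge0 => a _; exact: sqnorm_ge0.
have sfin : (s < +oo)%E.
  have [C cC /D_norm_lt[_ uC]] := approx 1 ltr01.
  have [mC C2] := measurable_cylindrical cC.
  apply: (@le_lt_trans _ _
    (2%:E * (\esum_(a in [set: A]) sqnorm PA (grad P (fun x => u x - C x)%R a)) +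
     2%:E * (\esum_(a in [set: A]) sqnorm PA (grad P C a)))%E); last first.
    apply: lte_add_pinfty; rewrite lte_mul_pinfty//.
      by apply: le_lt_trans uC _; rewrite ltry.
    exact: esum_grad_cylindrical.
  apply: esum_sqnorm_le_ae => a; [| exact: measurable_grad ..|].
    by apply: measurable_grad; exact: dist.
  have := gradB_ae HPA a mu mC u2 C2.
  apply: (@filterS _ _ (ae_filter_ringOfSetsType PA)) => x ->.
  by have := sqr_ge0 (grad P u a x - 2 * grad P C a x); lra.
exists (2 * fine s + 2); have fs0 : 0 <= fine s by exact: fine_ge0.
have sE : s = (fine s)%:E by rewrite fineK// ge0_fin_numE.
split.
- lra.
- by rewrite -/s sE lee_fin; lra.
(* [D_norm_lt] yields bounds by [h ^+ 2], and [h <= 1] makes this at most [h], hence at most both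
   [e] and 1. *)
move=> e e0; pose h := Num.min 1 e.
have h0 : 0 < h by rewrite lt_min ltr01.
have h1 : h <= 1 by rewrite ge_min lexx.
have he : h <= e by rewrite ge_min lexx orbT.
have hh : h ^+ 2 <= h by rewrite expr2 ler_piMr// ltW.
have [C cC /D_norm_lt[uC guC]] := approx h h0.
have [mC C2] := measurable_cylindrical cC.
exists C; split => //.
  by apply: le_trans uC _; rewrite lee_fin (le_trans hh).
apply: (@le_trans _ _ (2%:E * s +
   2%:E * (\esum_(a in [set: A]) sqnorm PA (grad P (fun x => u x - C x)%R a)))%E).
  apply: esum_sqnorm_le_ae => a; [exact: measurable_grad|..|].
  - by apply: measurable_grad; exact: dist.
  - exact: measurable_grad.
  have := gradB_ae HPA a mu mC u2 C2.
  apply: (@filterS _ _ (ae_filter_ringOfSetsType PA)) => x ->.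
  by have := sqr_ge0 (2 * grad P u a x - grad P C a x); lra.
have -> : (2 * fine s + 2)%:E = (2%:E * s + 2%:E * 1%:E)%E.
  by rewrite [in RHS]sE -!EFinM -EFinD mulr1.
apply: leeD2l; apply: lee_wpmul2l => //.
by apply: le_trans guC _; rewrite lee_fin (le_trans hh).
Qed.

End domain_of_gradient.

(** * Stein's method on the product space *)

Section stein_bound.
Context {R : realType} {A : countType} {d : A -> measure_display}.
Context {E : forall a, measurableType (d a)}.
Variable P : forall a, probability (E a) R.
Variable PA : probability (prod_space E) R.
Hypothesis HPA : is_product_measure P PA.
Local Notation T := (prod_space E).
Implicit Types (u v : T -> R) (a : A).

(* Testing [L^-1 F] only against cylindrical [f(C)], with [C] close to [F] in
   [D], avoids proving that [f(F)] belongs to the domain of [D]; the sum over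
   [a] is cut off by the uniform bound on the gradients of the [f(C)]. *)
Lemma integration_by_parts_approx (F G : T -> R) (f : R -> R) (e : R) :
  in_D P PA F -> is_Linv P PA F G -> measurable_fun setT f ->
  (forall s t, `|f s - f t| <= `|s - t|) -> 0 < e ->
  exists S : {fset A},
    `|\int[PA]_x (F x * f (F x)) +
      \sum_(a <- S) \int[PA]_x (grad P G a x * grad P (f \o F) a x)| <= e /\
    (\esum_(a in ~` [set` S])
       \int[PA]_x `|grad P F a x * - grad P G a x|%:E <= e%:E)%E.
Proof.
move=> FD [_ [_ [gradG_L2 gradG_sum _ divG]]] mf lf e0.
have [mF F2] := measurable_in_D FD.
have mfF : measurable_fun setT (f \o F) by exact: measurableT_comp.
have [M [M0 gradF_sum approx]] := in_D_approx HPA FD.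
pose U := grad P G; pose V C := grad P (f \o C).
have mU a : measurable_fun setT (U a) by have [] := Lfun2P PA (U a); move=> /(_ (gradG_L2 a))[].
have U2 a : (sqnorm PA (U a) < +oo)%E.
  by have [] := Lfun2P PA (U a); move=> /(_ (gradG_L2 a))[].
have Usum : (\esum_(a in [set: A]) sqnorm PA (U a) < +oo)%E.
  by move: gradG_sum; rewrite unlock.
have U0 : (0 <= \esum_(a in [set: A]) sqnorm PA (U a))%E.
  by apply: esum_ge0 => a _; exact: sqnorm_ge0.
have [N N0 UN] : exists2 N : R, 0 <= N &
    (\esum_(a in [set: A]) sqnorm PA (U a) <= N%:E)%E.
  exists (fine (\esum_(a in [set: A]) sqnorm PA (U a))%E); first exact: fine_ge0.
  by rewrite fineK// ge0_fin_numE.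
have subS (D : set A) (h : A -> \bar R) : (forall a, 0 <= h a)%E ->
    (\esum_(a in D) h a <= \esum_(a in [set: A]) h a)%E.
  move=> h0; rewrite [leRHS](esumID D)// setTI leeDl//.
  by apply: esum_ge0 => a _.
have e4 : 0 < e / 4 by rewrite divr_gt0.
have M4 : 0 <= 4 * M by rewrite mulr_ge0.
have [d1 d10 small1] := esum_integral_norm_mul_small (A := A) PA M4 e4.
have [d2 d20 small2] := esum_integral_norm_mul_small (A := A) PA N0 e4.
have F0 : 0 <= fine (sqnorm PA F) by rewrite fine_ge0// sqnorm_ge0.
have [d3 d30 small3] := integral_norm_mul_small PA F0 e4.
have FE : (sqnorm PA F <= (fine (sqnorm PA F))%:E)%E.
  by rewrite fineK// ge0_fin_numE// sqnorm_ge0.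
(* [S] is chosen before [C]. This is possible because [4 * M] bounds the gradients of f(C) whichever
   approximation [C] is taken. *)
have [S tailU] := esum_tail (fun a => sqnorm_ge0 PA (U a)) Usum d10.
exists S; split; last first.
  rewrite (@eq_esum _ _ _ _ (fun a => \int[PA]_x `|U a x * grad P F a x|%:E)%E).
    apply: (@le_trans _ _ (e / 4)%:E); last by rewrite lee_fin; lra.
    apply: small1 => // [a|]; first exact: measurable_grad.
    apply: le_trans (le_trans (subS _ _ _) gradF_sum) _ => [a|].
      exact: sqnorm_ge0.
    by rewrite lee_fin; lra.
  by move=> a _; apply: eq_integral => x _; rewrite mulrN normrN mulrC.
(* Each index of [S] adds at most [4 * eta] to the squared distance between the gradients of f(C)
   and f(F); the [+ 1] keeps [k] positive when [S] is empty. *)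
pose k : R := 4 * (size S)%:R + 1.
have k0 : 0 < k by rewrite ltr_wpDl// mulr_ge0.
pose eta := Num.min d3 (d2 / k).
have eta0 : 0 < eta by rewrite lt_min d30 divr_gt0.
have [C [cC FC gradC]] := approx eta eta0.
have [mC C2] := measurable_cylindrical cC.
have cfC : cylindrical PA (f \o C) := cylindrical_lip mf lf cC.
have [mfC fC2] := measurable_cylindrical cfC.
have mVC a : measurable_fun setT (V C a) by exact: measurable_grad.
have mVF a : measurable_fun setT (V F a) by exact: measurable_grad.
have VC_sum : (\esum_(a in [set: A]) sqnorm PA (V C a) <= (4 * M)%:E)%E.
  apply: (@le_trans _ _ (\esum_(a in [set: A]) (4%:E * sqnorm PA (grad P C a)))%E).
    by apply: le_esum => a _; exact: sqnorm_grad_lip.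
  rewrite ge0_esumZl//; last by move=> a; exact: sqnorm_ge0.
  by rewrite EFinM lee_wpmul2l.
have VC2 a : (sqnorm PA (V C a) < +oo)%E.
  by apply: (le_lt_trans (sqnorm_grad_le HPA a mfC)); rewrite lte_mul_pinfty.
have fF2 : (sqnorm PA (f \o F) < +oo)%E by exact: sqnorm_lip_comp.
have VF2 a : (sqnorm PA (V F a) < +oo)%E.
  by apply: (le_lt_trans (sqnorm_grad_le HPA a mfF)); rewrite lte_mul_pinfty.
pose t a := \int[PA]_x (U a x * V C a x).
have iUC a : PA.-integrable setT (EFin \o (fun x => U a x * V C a x)).
  exact: integrable_mul_sqnorm.
have iUF a : PA.-integrable setT (EFin \o (fun x => U a x * V F a x)).
  exact: integrable_mul_sqnorm.
have iFC : PA.-integrable setT (EFin \o (fun x => F x * f (C x))).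
  exact: (@integrable_mul_sqnorm _ _ _ PA F (f \o C)).
have iFF : PA.-integrable setT (EFin \o (fun x => F x * f (F x))).
  exact: (@integrable_mul_sqnorm _ _ _ PA F (f \o F)).
have usum_t : usum t = - \int[PA]_x (F x * f (C x)).
  have := divG (f \o C) (cylindrical_in_D P cfC); rewrite unlock => h.
  transitivity (\int[PA]_x (- F x * f (C x))); first exact: h.
  transitivity (\int[PA]_x (-1 * (F x * f (C x)))).
    by apply: eq_Rintegral => x _; ring.
  by rewrite RintegralZl// mulN1r.
(* Three errors of [e / 4] each: cutting the sum at [S], replacing f(C) by f(F) in the gradients
   over [S], and replacing it in the pairing with [F]. *)
have cut : `|usum t - \sum_(a <- S) t a| <= e / 4.
  rewrite -lee_fin; apply: (le_trans (usum_dist_le t S)).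
  apply: (@le_trans _ _ (\esum_(a in ~` [set` S]) \int[PA]_x `|U a x * V C a x|%:E)%E).
    by apply: le_esum => a _; exact: normr_Rintegral_le.
  apply: small1 => //.
  by apply: le_trans VC_sum; apply: subS => a; exact: sqnorm_ge0.
have swap : `|\sum_(a <- S) t a - \sum_(a <- S) \int[PA]_x (U a x * V F a x)| <= e / 4.
  rewrite -sumrB; apply: (le_trans (ler_norm_sum _ _ _)).
  rewrite -lee_fin -sumEFin.
  apply: (@le_trans _ _ (\esum_(a in [set` S])
      \int[PA]_x `|(V C a x - V F a x) * U a x|%:E)%E).
    rewrite esum_fset_nneg; last by move=> a; apply: integral_ge0.
    apply: lee_sum => a _; rewrite -RintegralB//.
    rewrite (@eq_Rintegral _ _ _ PA setT (fun x => (V C a x - V F a x) * U a x)); last first.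
      by move=> x _; ring.
    apply: normr_Rintegral_le; apply: integrable_mul_sqnorm => //.
      exact: measurable_funB.
    have h : (sqnorm PA (fun x => V C a x - V F a x)%R <=
        2%:E * sqnorm PA (V C a) + 2%:E * sqnorm PA (V F a))%E.
      apply: sqnorm_le_ae => //; first exact: measurable_funB.
      by apply: aeW => x /=; have := sqr_ge0 (V C a x + V F a x); lra.
    apply: (le_lt_trans h).
    by rewrite lte_add_pinfty// lte_mul_pinfty.
  apply: small2 => //.
  - by move=> a; exact: measurable_funB.
  - rewrite esum_fset_nneg; last by move=> a; exact: sqnorm_ge0.
    apply: (@le_trans _ _ (\sum_(a <- S) (4 * eta)%:E)%E).
      apply: lee_sum => a _.
      have ae_VCF : sqnorm PA (fun x => V C a x - V F a x) =
          sqnorm PA (grad P (fun x => (f \o C) x - (f \o F) x) a).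
        apply: ae_eq_integral => //.
        - by apply: measurable_EFin_sqr; exact: measurable_funB.
        - apply: measurable_EFin_sqr; apply: measurable_grad.
          exact: measurable_funB.
        have := gradB_ae HPA a mfC mfF fC2 fF2.
        by apply: (@filterS _ _ (ae_filter_ringOfSetsType PA)) => x h _; rewrite h.
      rewrite ae_VCF.
      have mfCF : measurable_fun setT (fun x => (f \o C) x - (f \o F) x).
        exact: measurable_funB.
      apply: (le_trans (sqnorm_grad_le HPA a mfCF)).
      rewrite EFinM lee_wpmul2l//; apply: le_trans FC.
      apply: ge0_le_integral => //.
      + by move=> x _; rewrite lee_fin sqr_ge0.
      + exact: measurable_EFin_sqr.
      + by apply: measurable_EFin_sqr; exact: measurable_funB.
      + move=> x _; rewrite lee_fin -[leLHS]real_normK ?num_real//.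
        by rewrite -[leRHS]real_normK ?num_real// lerXn2r ?nnegrE//= [leRHS]distrC lf.
    rewrite sumEFin lee_fin big_const_seq count_predT iter_addr_0 -mulr_natr.
    have eta2 : eta <= d2 / k by rewrite ge_min lexx orbT.
    have : eta * k <= d2 by rewrite -ler_pdivlMr.
    by rewrite /k; have := ltW eta0; lra.
  - by apply: le_trans UN; apply: subS => a; exact: sqnorm_ge0.
have last : `|\int[PA]_x (F x * f (C x)) - \int[PA]_x (F x * f (F x))| <= e / 4.
  apply: Rintegral_dist_le => //.
  apply: (@le_trans _ _ (\int[PA]_x `|(F x - C x) * F x|%:E)%E).
    apply: ge0_le_integral => //.
    - apply/measurable_EFinP; apply: measurableT_comp => //.
      by apply: measurable_funB; exact: measurable_funM.
    - apply/measurable_EFinP; apply: measurableT_comp => //.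
      by apply: measurable_funM => //; exact: measurable_funB.
    move=> x _; rewrite lee_fin -mulrBr [leLHS]normrM normrM [leRHS]mulrC.
    by rewrite ler_wpM2l// distrC; exact: lf.
  apply: small3 => //; first exact: measurable_funB.
  by apply: le_trans FC _; rewrite lee_fin ge_min lexx.
rewrite -/U -/(V F).
move: cut swap last; rewrite usum_t.
set I1 := \int[PA]_x (F x * f (C x)); set I2 := \int[PA]_x (F x * f (F x)).
set S1 := \sum_(a <- S) t a; set S2 := \sum_(a <- S) _.
rewrite !ler_norml => /andP[h1 h2] /andP[h3 h4] /andP[h5 h6].
by apply/andP; split; lra.
Qed.

Lemma ae_seq_all (s : seq A) (Pr : A -> T -> Prop) :
  (forall a, {ae PA, forall x, Pr a x}) ->
  {ae PA, forall x, forall a, a \in s -> Pr a x}.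
Proof.
move=> h; elim: s => [|b s ih]; first exact: aeW.
have := ih; have := h b.
apply: (@filterS2 _ _ (ae_filter_ringOfSetsType PA)) => x hb hs a.
by rewrite inE => /predU1P[->|/hs].
Qed.

Definition resampling_variance u a (x : T) : \bar R :=
  (\int[P a]_y ((u x - u (dfwith x a y)) ^+ 2)%:E)%E.

Lemma measurable_resampling_variance u a : measurable_fun setT u ->
  measurable_fun setT (resampling_variance u a).
Proof.
move=> mu; pose h (z : T * E a) := ((u z.1 - u (update z)) ^+ 2)%:E.
have mh : measurable_fun setT h.
  apply/measurable_EFinP; apply: measurable_funX; apply: measurable_funB.
    by apply: measurableT_comp => //; exact: measurable_fst.
  exact: (measurable_fun_update (a := a) mu).
have h0 z : (0 <= h z)%E by rewrite lee_fin sqr_ge0.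
exact: (@measurable_fun_fubini_tonelli_F _ _ _ _ _ (P a) h mh h0).
Qed.

(* Taylor expansion of [f] between [F x] and [F (dfwith x a y)], averaged over [y]. *)
Lemma grad_comp_approx u (f f' : R -> R) a (x : T) : measurable_fun setT f ->
  (forall s t, `|f s - f t| <= `|s - t|) ->
  (forall s t, `|f t - f s - f' s * (t - s)| <= (t - s) ^+ 2) ->
  measurable_fun setT u ->
  (P a).-integrable setT (EFin \o (fun y => u (dfwith x a y))) ->
  (`|grad P (f \o u) a x - f' (u x) * grad P u a x|%:E <=
   resampling_variance u a x)%E.
Proof.
move=> mf lf tf mu iu.
have mux := measurable_fun_dfwith (a := a) x mu.
have ifu := integrable_lip_comp mf lf mux iu.
have ic (k : R) : (P a).-integrable setT (EFin \o cst k).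
  exact: finite_measure_integrable_cst.
have gradE (h : T -> R) : (P a).-integrable setT (EFin \o (fun y => h (dfwith x a y))) ->
    grad P h a x = \int[P a]_y (h x - h (dfwith x a y)).
  move=> ih; rewrite RintegralB//; last exact: ic.
  by rewrite Rintegral_cst// [X in fine X](probability_setT (P a)) mulr1.
have iB (h : T -> R) : (P a).-integrable setT (EFin \o (fun y => h (dfwith x a y))) ->
    (P a).-integrable setT (EFin \o (fun y => h x - h (dfwith x a y))).
  by move=> ih; exact: (integrableB measurableT (ic (h x)) ih).
have iZ : (P a).-integrable setT
    (EFin \o (fun y => f' (u x) * (u x - u (dfwith x a y)))).
  rewrite (_ : _ \o _ = fun y => ((f' (u x))%:E *
    (u x - u (dfwith x a y))%R%:E)%E)//.
  by apply: integrableZl => //; exact: iB.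
rewrite (gradE (f \o u))// (gradE u)// -RintegralZl//; last exact: iB.
rewrite -RintegralB//; last exact: (iB (f \o u)).
have iD := integrableB measurableT (iB (f \o u) ifu) iZ.
apply: (le_trans (normr_Rintegral_le iD)).
apply: ge0_le_integral => //.
- apply/measurable_EFinP; apply: measurableT_comp => //.
  exact/measurable_EFinP/(measurable_int _ iD).
- by apply: measurable_EFin_sqr; exact: measurable_funB.
move=> y _; rewrite lee_fin /=.
have := tf (u x) (u (dfwith x a y)).
rewrite -[X in X <= _ -> _]normrN => h; rewrite -[leRHS]sqrrN opprB.
by apply: le_trans h; rewrite le_eqVlt; apply/orP; left; apply/eqP; congr `|_|; ring.
Qed.

Lemma stein_bound (F G : T -> R) (phi f f' : R -> R) (m : R) :
  in_D P PA F -> is_Linv P PA F G -> measurable_fun setT phi ->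
  (forall s t, `|phi s - phi t| <= `|s - t|) ->
  (forall t, f' t = t * f t + (phi t - m)) -> (forall t, `|f' t| <= 1) ->
  (forall s t, `|f s - f t| <= `|s - t|) -> continuous f' ->
  (forall s t, `|f t - f s - f' s * (t - s)| <= (t - s) ^+ 2) ->
  (`|m - \int[PA]_x phi (F x)|%:E <=
   \int[PA]_x `|1 - usum (fun a => (grad P F a x * - grad P G a x)%R)|%:E +
   \esum_(a in [set: A])
     \int[PA]_x (resampling_variance F a x * `|grad P G a x|%:E))%E.
Proof.
move=> FD Linv mphi lphi f'E f'1 lf cf' tf.
have [mF F2] := measurable_in_D FD.
have cf : continuous f by apply: (@lip_continuous R f 1) => s t; rewrite mul1r.
have mf : measurable_fun setT f := continuous_measurable_fun cf.
have mf' : measurable_fun setT f' := continuous_measurable_fun cf'.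
pose U := grad P G; pose W := grad P F; pose V := grad P (f \o F).
have mfF : measurable_fun setT (f \o F) by exact: measurableT_comp.
have fF2 : (sqnorm PA (f \o F) < +oo)%E by exact: sqnorm_lip_comp.
have [mG G2] : measurable_fun setT G /\ (sqnorm PA G < +oo)%E.
  by have [_ [/measurable_in_D]] := Linv.
have mU a : measurable_fun setT (U a) by exact: measurable_grad.
have mW a : measurable_fun setT (W a) by exact: measurable_grad.
have mV a : measurable_fun setT (V a) by exact: measurable_grad.
have mQ a : measurable_fun setT (resampling_variance F a).
  exact: measurable_resampling_variance.
have Q0 a x : (0 <= resampling_variance F a x)%E.
  by apply: integral_ge0 => y _; rewrite lee_fin sqr_ge0.
have grad2 u a : measurable_fun setT u -> (sqnorm PA u < +oo)%E ->
    (sqnorm PA (grad P u a) < +oo)%E.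
  by move=> mu u2; apply: (le_lt_trans (sqnorm_grad_le HPA a mu)); rewrite lte_mul_pinfty.
have iUV a : PA.-integrable setT (EFin \o (fun x => U a x * V a x)).
  by apply: integrable_mul_sqnorm => //; exact: grad2.
have iFf : PA.-integrable setT (EFin \o (fun x => F x * f (F x))).
  exact: (@integrable_mul_sqnorm _ _ _ PA F (f \o F)).
have iphi : PA.-integrable setT (EFin \o (fun x => phi (F x))).
  by apply: (integrable_lip_comp mphi lphi mF); exact: integrable_sqnorm.
have if' : PA.-integrable setT (EFin \o (fun x => f' (F x))).
  apply: (@le_integrable _ _ _ _ _ measurableT _ (EFin \o cst 1)).
  - by apply/measurable_EFinP; exact: measurableT_comp.
  - by move=> x _ /=; rewrite lee_fin normr1.
  - exact: finite_measure_integrable_cst.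
apply/lee_addgt0Pr => e e0; have e2 : 0 < e / 2 by rewrite divr_gt0.
have [S [ibp tail]] := integration_by_parts_approx FD Linv mf lf e2.
(* By the approximate integration by parts, the mean of [Z] is within [e / 2] of E[phi(F)] - m. *)
pose Z x := f' (F x) + \sum_(a <- S) U a x * V a x.
have iS : PA.-integrable setT (EFin \o (fun x => \sum_(a <- S) U a x * V a x)).
  exact: integrable_EFin_sum.
have iZ : PA.-integrable setT (EFin \o Z) by exact: (integrableD measurableT if' iS).
have phiE : \int[PA]_x phi (F x) =
    \int[PA]_x f' (F x) - \int[PA]_x (F x * f (F x)) + m.
  rewrite -RintegralB// -[m in RHS]mulr1.
  rewrite -[X in m * X]/(fine 1%E) -(probability_setT PA) -Rintegral_cst//.
  rewrite -RintegralD//; last exact: finite_measure_integrable_cst.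
    by apply: eq_Rintegral => x _ /=; rewrite f'E; ring.
  exact: (integrableB measurableT if' iFf).
have ZE : \int[PA]_x Z x =
    \int[PA]_x f' (F x) + \sum_(a <- S) \int[PA]_x (U a x * V a x).
  by rewrite RintegralD// Rintegral_sum.
apply: (@le_trans _ _ (`|\int[PA]_x Z x| + e / 2)%:E).
  rewrite lee_fin phiE; move: ibp ZE; rewrite -/U -/V.
  move: (\sum_(a <- S) _) (\int[PA]_x Z x) => s z ibp zE.
  have -> : m - (\int[PA]_x f' (F x) - \int[PA]_x (F x * f (F x)) + m) =
      - z + (\int[PA]_x (F x * f (F x)) + s) by rewrite zE; ring.
  by rewrite (le_trans (ler_normD _ _))// normrN lerD2l.
(* A pointwise bound of [|Z|] in three pieces: the first term of the theorem, the error of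
   truncating its sum to [S], and the Taylor remainders over [S]. *)
pose B1 x := `|1 - usum (fun a => W a x * - U a x)|%:E.
pose B2 x := (\esum_(a in ~` [set` S]) `|W a x * - U a x|%:E)%E.
pose B3 x := (\sum_(a <- S) resampling_variance F a x * `|U a x|%:E)%E.
have mWU a : measurable_fun setT (fun x => W a x * - U a x).
  by apply: measurable_funM => //; exact: measurableT_comp.
have mWUn a : measurable_fun setT (fun x => `|W a x * - U a x|%:E).
  by apply/measurable_EFinP; exact: measurableT_comp.
have mQU a : measurable_fun setT (fun x => resampling_variance F a x * `|U a x|%:E)%E.
  apply: emeasurable_funM => //.
  by apply/measurable_EFinP; exact: measurableT_comp.
have mB1 : measurable_fun setT B1.
  apply/measurable_EFinP; apply: measurableT_comp => //.
  by apply: measurable_funB => //; exact: (measurable_usum mWU).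
have mB2 : measurable_fun setT B2 by exact: emeasurable_esum.
have mB3 : measurable_fun setT B3 by exact: emeasurable_sum.
have B10 x : (0 <= B1 x)%E by rewrite lee_fin.
have B20 x : (0 <= B2 x)%E by apply: esum_ge0 => a _; rewrite lee_fin.
have QU0 a x : (0 <= resampling_variance F a x * `|U a x|%:E)%E.
  by rewrite mule_ge0// lee_fin.
have B30 x : (0 <= B3 x)%E by apply: sume_ge0.
have ZB : (\int[PA]_x `|Z x|%:E <= \int[PA]_x (B1 x + B2 x + B3 x))%E.
  apply: ae_ge0_le_integral => //.
  - apply/measurable_EFinP; apply: measurableT_comp => //.
    by have /measurable_EFinP := measurable_int PA iZ.
  - by move=> x _; rewrite !adde_ge0.
  - by apply: emeasurable_funD => //; exact: emeasurable_funD.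
  have := ae_seq_all S (fun a => ae_integrable_dfwith HPA a mF F2).
  apply: (@filterS _ _ (ae_filter_ringOfSetsType PA)) => x hx _.
  (* Comparing D_a f(F) with f'(F) D_aF isolates the factor [1 - sum], whose coefficient f'(F) is at
     most 1 in absolute value. *)
  have ZE' : Z x = f' (F x) * (1 - \sum_(a <- S) (W a x * - U a x)) +
      \sum_(a <- S) U a x * (V a x - f' (F x) * W a x).
    rewrite /Z mulrBr mulr1 -addrA; congr (_ + _).
    rewrite mulr_sumr -sumrN -big_split/=; apply: eq_bigr => a _; ring.
  rewrite ZE'.
  apply: (@le_trans _ _ (`|1 - \sum_(a <- S) (W a x * - U a x)|%:E +
      \sum_(a <- S) `|U a x * (V a x - f' (F x) * W a x)|%:E)%E).
    rewrite sumEFin -EFinD lee_fin (le_trans (ler_normD _ _))//.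
    apply: lerD; last exact: ler_norm_sum.
    by rewrite normrM ler_piMl.
  apply: leeD.
    apply: (@le_trans _ _ (B1 x + `|usum (fun a => W a x * - U a x) -
        \sum_(a <- S) (W a x * - U a x)|%:E)%E).
      rewrite -EFinD lee_fin.
      rewrite (_ : 1 - _ = (1 - usum (fun a => W a x * - U a x)) +
        (usum (fun a => W a x * - U a x) - \sum_(a <- S) (W a x * - U a x))).
        exact: ler_normD.
      by ring.
    by apply: leeD2l; exact: usum_dist_le.
  rewrite /B3 big_seq [leRHS]big_seq; apply: lee_sum => a aS.
  rewrite normrM mulrC EFinM lee_wpmul2r ?lee_fin//.
  exact: (grad_comp_approx mf lf tf mF (hx a aS)).
rewrite EFinD; apply: (@le_trans _ _ (\int[PA]_x (B1 x + B2 x + B3 x) + (e / 2)%:E)%E).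
  by apply: leeD2r; apply: le_trans ZB; exact: normr_Rintegral_le.
rewrite ge0_integralD//; last 2 first.
- by move=> x _; rewrite adde_ge0.
- exact: emeasurable_funD.
rewrite ge0_integralD// integral_esum//.
rewrite ge0_integral_sum//.
(* One half pays for the integration by parts, the other for the indices outside [S]. *)
have -> : e%:E = ((e / 2)%:E + (e / 2)%:E)%E.
  by rewrite -EFinD; congr EFin; field.
rewrite addeA; apply: leeD2r.
rewrite -addeA [leRHS]addeAC -[leRHS]addeA; apply: leeD2l.
apply: leeD => //.
rewrite (esum_fsetID S); last by move=> a; apply: integral_ge0.
by rewrite leeDl// esum_ge0// => a _; apply: integral_ge0.
Qed.

End stein_bound.

Unset Implicit Arguments.

Theorem theorem5p9 (R : realType) (A : countType) (E : A -> ptopologicalType)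
    (HE : forall a, polish R (E a))
    (P : forall a, probability (borel (E a)) R)
    (PA : probability (prod_space (fun a => borel (E a))) R)
    (HPA : is_product_measure P PA)
    (H : set (R -> R)) (HH : H `<=` Lip 1)
    (F : {RV PA >-> R}) (FD : in_D P PA F) (F0 : ('E_PA[F] = 0)%E)
    (LinvF : prod_space (fun a => borel (E a)) -> R)
    (HLinvF : is_Linv P PA F LinvF) :
  (kappa H (normal_prob 0 1) (distribution PA F) <=
   'E_PA[fun x => `|1 - usum (fun a =>
                        grad P F a x * (- grad P LinvF a x))|%R] +
   \esum_(a in [set: A])
     \int[PA]_x ((\int[P a]_y ((F x - F (dfwith x a y)) ^+ 2)%:E) *
                 `|grad P LinvF a x|%:E))%E.
Proof.
apply: ge_ereal_sup => _ [phi Hphi <-]; have lphi := HH _ Hphi.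
have [m [mE [f [f' [f'E f'1 lf cf' tf]]]]] := stein_equation lphi.
have lphi1 s t : `|phi s - phi t| <= `|s - t|.
  by rewrite -[leRHS]mul1r; exact: lphi.
have mphi : measurable_fun [set: R] phi.
  exact: continuous_measurable_fun (lip_continuous lphi).
have [mF F2] := measurable_in_D FD.
have iphi : PA.-integrable [set: _] (EFin \o (phi \o F)).
  by apply: (integrable_lip_comp mphi lphi1 mF); exact: integrable_sqnorm.
have -> : (\int[distribution PA F]_x (phi x)%:E = (\int[PA]_x phi (F x))%:E)%E.
  rewrite (@integral_distribution _ _ _ _ _ PA F (EFin \o phi))//.
    by rewrite /Rintegral fineK//; exact: integrable_fin_num iphi.
  exact/measurable_EFinP.
rewrite [X in `|X - _|%E]mE unlock.
exact: (stein_bound HPA FD HLinvF mphi lphi1 f'E f'1 lf cf' tf).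
Qed.
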